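(* Let $n\ge2$ be an integer, $h=2/n$, and let $K\in\mathbb{C}^{(n-1)\times(n-1)}$ be the tridiagonal matrix $$K=\frac{1}{h^2}\begin{bmatrix}2&-1&&\\-1&\ddots&\ddots&\\&\ddots&\ddots&-1\\&&-1&2\end{bmatrix}.$$ Let $\mathcal{F}\in\mathbb{C}^{(n-1)\times(n-1)\times(n-1)}$ be the tensor with all entries equal to $1$, and let $\mathcal{X}\in\mathbb{C}^{(n-1)\times(n-1)\times(n-1)}$ be the solution of $$\mathcal{X}\times_1K+\mathcal{X}\times_2K+\mathcal{X}\times_3K=\mathcal{F}$$ (the second-order finite difference discretization of $-(u_{xx}+u_{yy}+u_{zz})=1$ on $[-1,1]^3$ with zero Dirichlet boundary conditions on an equispaced grid). Then for every $0<\epsilon<1$, $$p^{\rm TT}_\epsilon(\mathcal{X})\le n(s_1^2+2s_1),\qquad s_1=\left\lceil\frac{1}{\pi^2}\log\!\left(\frac{16(n^2+2)(2n^2+1)}{9n^2}\right)\log\!\left(\frac{4\sqrt3}{\epsilon}\right)\right\rceil.$$ In particular, $\mathcal{X}$ can be approximated to relative accuracy $\epsilon$ in the Frobenius norm by a tensor in tensor-train format with $\mathcal{O}(n(\log n)^2(\log(1/\epsilon))^2)$ degrees of freedom, as $n\to\infty$ and $\epsilon\to0$.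
   Context: Mode product: $(\mathcal{X}\times_k A)_{i_1,\ldots,i_{k-1},j,i_{k+1},\ldots,i_d}=\sum_{i_k=1}^{n_k}\mathcal{X}_{i_1,\ldots,i_d}A_{j,i_k}$. Frobenius norm: $\|\mathcal{X}\|_F^2=\sum|\mathcal{X}_{i_1,\ldots,i_d}|^2$ (sum over all entries). Tensor-train format: $\mathcal{Y}\in\mathbb{C}^{n_1\times\cdots\times n_d}$ has tensor-train rank at most $(s_0,\ldots,s_d)$, with $s_0=s_d=1$, if there are matrix-valued functions $H_k:\{1,\ldots,n_k\}\to\mathbb{C}^{s_{k-1}\times s_k}$, $1\le k\le d$, with $\mathcal{Y}_{i_1,\ldots,i_d}=H_1(i_1)\cdots H_d(i_d)$ for all indices. Storing such a decomposition takes $\sum_{k=1}^d s_{k-1}s_kn_k$ degrees of freedom. For $0<\epsilon<1$, $p^{\rm TT}_\epsilon(\mathcal{X})$ denotes the smallest number of degrees of freedom with which one can store, in tensor-train format, some tensor $\tilde{\mathcal{X}}$ satisfying $\|\mathcal{X}-\tilde{\mathcal{X}}\|_F\le\epsilon\|\mathcal{X}\|_F$. *)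

(* Defs.v *)
From HB Require Import structures.
From mathcomp Require Import all_boot all_order all_algebra.
From mathcomp Require Import complex.
From mathcomp Require Import all_classical all_reals all_analysis.

Set Implicit Arguments.
Unset Strict Implicit.
Unset Printing Implicit Defensive.

Import Order.TTheory GRing.Theory Num.Theory.
Import numFieldNormedType.Exports.
Import ComplexField.Normc.

Local Open Scope ring_scope.
Local Open Scope complex_scope.

(* Modes and indices are numbered from 0: mode k : 'I_d of size n k is the
   mathematical mode k + 1. *)
Definition mindex (d : nat) (n : 'I_d -> nat) : finType :=
  {dffun forall k : 'I_d, 'I_(n k)}.

Definition tensor (R : realType) (d : nat) (n : 'I_d -> nat) :=
  {ffun mindex n -> R[i]}.

(* Only square matrices A are needed; the general mode product would change the
   size of mode k. *)
Definition mode_prod (R : realType) (d : nat) (n : 'I_d -> nat)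
    (X : tensor R n) (k : 'I_d) (A : 'M[R[i]]_(n k)) : tensor R n :=
  [ffun i : mindex n =>
     \sum_(l < n k) X (finfun (eqtype.dfwith (i : forall k, 'I_(n k)) l)) * A (i k) l].

Definition frob_norm (R : realType) (d : nat) (n : 'I_d -> nat)
    (X : tensor R n) : R :=
  Num.sqrt (\sum_(i : mindex n) normc (X i) ^+ 2).

(* tt_prod H i k = H_1(i_1) ... H_k(i_k), the product of the first k cores. *)
Fixpoint tt_prod (R : realType) (d : nat) (n : 'I_d -> nat) (s : nat -> nat)
    (H : forall k : 'I_d, 'I_(n k) -> 'M[R[i]]_(s k, s k.+1)) (i : mindex n)
    (k : nat) : (k <= d)%N -> 'M[R[i]]_(s 0%N, s k) :=
  match k with
  | 0 => fun _ => 1%:M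
  | l.+1 => fun lt_l_d : (l < d)%N =>
      tt_prod H i (ltnW lt_l_d) *m H (Ordinal lt_l_d) (i (Ordinal lt_l_d))
  end.

(* Y has tensor-train rank at most (s 0, ..., s d); s is irrelevant past d.
   As s 0 = s d = 1, the product of the cores is the 1 x 1 matrix (Y i). *)
Definition tt_rank_le (R : realType) (d : nat) (n : 'I_d -> nat)
    (s : nat -> nat) (Y : tensor R n) : Prop :=
  [/\ s 0%N = 1%N, s d = 1%N &
    exists H : forall k : 'I_d, 'I_(n k) -> 'M[R[i]]_(s k, s k.+1),
      forall i : mindex n, tt_prod H i (leqnn d) = const_mx (Y i)].

Definition tt_storage (d : nat) (n : 'I_d -> nat) (s : nat -> nat) : nat :=
  (\sum_(k < d) s k * s k.+1 * n k)%N.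

Definition tt_approx (R : realType) (d : nat) (n : 'I_d -> nat) (e : R)
    (X : tensor R n) (m : nat) : Prop :=
  exists (s : nat -> nat) (Y : tensor R n),
    [/\ tt_rank_le s Y, tt_storage n s = m &
        frob_norm (X - Y) <= e * frob_norm X].

(* The least m such that tt_approx e X m. The default 0 is never reached when
   0 < d and 0 <= e: see pTTP. *)
Definition pTT (R : realType) (d : nat) (n : 'I_d -> nat) (e : R)
    (X : tensor R n) : nat :=
  if pselect (exists m, `[< tt_approx e X m >]) is left ex_m
  then ex_minn ex_m else 0%N.

Definition fd_matrix (R : realType) (n : nat) : 'M[R[i]]_n.-1 :=
  let h : R[i] := 2 / n%:R in
  h ^- 2 *: \matrix_(i < n.-1, j < n.-1)
    (if i == j then 2
     else if (i.+1 == j :> nat) || (j.+1 == i :> nat) then -1 else 0).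

Definition fd_poisson_solution (R : realType) (n : nat)
    (X : tensor R (fun _ : 'I_3 => n.-1)) : Prop :=
  \sum_(k < 3) mode_prod X (k := k) (fd_matrix R n) = [ffun=> 1].

Section Existence.
Variables (R : realType) (d : nat) (n : 'I_d -> nat).
Hypothesis d_gt0 : (0 < d)%N.

Let rk (J : mindex n) : nat := enum_rank J.
Let s (k : nat) : nat := if (0 < k < d)%N then #|mindex n| else 1%N.

Let core (X : tensor R n) (k : 'I_d) (j : 'I_(n k)) :
    'M[R[i]]_(s k, s k.+1) :=
  \matrix_(a, b) \sum_(J : mindex n |
    [&& (0 < k)%N ==> (rk J == a), (k.+1 < d)%N ==> (rk J == b) & J k == j])
    (if k.+1 == d then X J else 1).

Let prodE (X : tensor R n) (i : mindex n) (k : nat) (lekd : (k <= d)%N) :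
  (0 < k)%N -> tt_prod (core X) i lekd = \matrix_(a, b) \sum_(J : mindex n |
     ((k < d)%N ==> (rk J == b)) && [forall l : 'I_d, (l < k)%N ==> (J l == i l)])
     (if k == d then X J else 1).
Proof.
elim: k lekd => // k IHk ltkd _ /=.
have [k0|k_gt0] := posnP k.
  subst k; rewrite mul1mx; apply/matrixP=> a b; rewrite !mxE.
  apply: eq_bigl => J /=; congr (_ && _).
  apply/eqP/forallP => [Ji l|/(_ (Ordinal ltkd))/eqP//].
  apply/implyP; rewrite ltnS leqn0 => /eqP l0.
  by rewrite (_ : l = Ordinal ltkd) ?Ji//; apply: val_inj.
rewrite IHk//; apply/matrixP=> a b; rewrite !mxE.
have k_d : k == d = false by rewrite ltn_eqF.
under [LHS]eq_bigr do rewrite !mxE k_d ltkd /= k_gt0 /= mulr_sumr.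
rewrite (exchange_big_dep (fun J : mindex n =>
   ((k.+1 < d)%N ==> (rk J == b)) && (J (Ordinal ltkd) == i (Ordinal ltkd))))/=;
  last by move=> c J _ /and3P[_ -> ->].
rewrite (bigID (fun J : mindex n => [forall l : 'I_d, (l < k)%N ==> (J l == i l)]))/=.
have sk : s k = #|mindex n| by rewrite /s k_gt0 ltkd.
have key (J : mindex n) :
  \sum_(c < s k | [&& rk J == c, (k.+1 < d)%N ==> (rk J == b) & J (Ordinal ltkd) == i (Ordinal ltkd)])
   (\sum_(J0 : mindex n | (rk J0 == c) && [forall l : 'I_d, (l < k)%N ==> (J0 l == i l)]) (1 : R[i])) * (if k.+1 == d then X J else 1) =
  if ((k.+1 < d)%N ==> (rk J == b)) && (J (Ordinal ltkd) == i (Ordinal ltkd)) && [forall l : 'I_d, (l < k)%N ==> (J l == i l)] then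
   (if k.+1 == d then X J else 1) else 0.
  case E : (((k.+1 < d)%N ==> (rk J == b)) && (J (Ordinal ltkd) == i (Ordinal ltkd))) => /=; last first.
    by rewrite big_pred0 // => c /=; rewrite andbF.
  have rJ : (rk J < s k)%N by rewrite sk /rk; apply: ltn_ord.
  rewrite (big_pred1 (Ordinal rJ)); last first.
    by move=> c /=; rewrite andbT -val_eqE /= eq_sym.
  rewrite big_mkcondr (big_pred1 J) /=; last first.
    by move=> J0 /=; rewrite val_eqE (inj_eq enum_rank_inj).
  by case: ifP; rewrite ?mul1r ?mul0r.
rewrite [X in _ + X]big1 ?addr0; last first.
  by move=> J /andP[_ /negPf nJ]; rewrite key nJ andbF.
rewrite (eq_bigr (fun J => (if k.+1 == d then X J else 1))); last first.
  by move=> J /andP[HJ1 HJ2]; rewrite key HJ1 HJ2.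
apply: eq_bigl => J; rewrite -!andbA; congr (_ && _).
apply/andP/forallP => [[/eqP Jk /forallP Jl] l|Jl].
  apply/implyP; rewrite ltnS leq_eqVlt => /orP[/eqP lk|lk].
    by rewrite (_ : l = Ordinal ltkd) ?Jk//; apply: val_inj.
  exact: (implyP (Jl l)).
split; first exact: (implyP (Jl (Ordinal ltkd))) (ltnSn _).
by apply/forallP=> l; apply/implyP => lk; apply: (implyP (Jl l)); apply: ltnW.
Qed.

Lemma tt_approx_exists (e : R) (X : tensor R n) :
  0 <= e -> exists m, tt_approx e X m.
Proof.
move=> e_ge0; exists (tt_storage n s), s, X; split=> //; last first.
  rewrite subrr {1}/frob_norm big1 ?sqrtr0 ?mulr_ge0 ?sqrtr_ge0// => i _.
  by rewrite ffunE normc0 expr0n.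
split; [by []|by rewrite /s ltnn andbF|].
exists (core X) => i; rewrite prodE//; apply/matrixP=> a b; rewrite !mxE ltnn eqxx /=.
rewrite (big_pred1 i) // => J /=; apply/forallP/eqP => [Ji|-> l]; last by rewrite eqxx implybT.
by apply/ffunP=> l; apply/eqP; apply: (implyP (Ji l)).
Qed.

Lemma pTTP (e : R) (X : tensor R n) : 0 <= e ->
  tt_approx e X (pTT e X) /\ (forall m, tt_approx e X m -> (pTT e X <= m)%N).
Proof.
move=> e_ge0; rewrite /pTT; case: pselect => [ex_m|[]].
  case: ex_minnP => m /asboolP Xm min_m; split=> // m' Xm'.
  by apply: min_m; apply/asboolP.
by have [m Xm] := tt_approx_exists X e_ge0; exists m; apply/asboolP.
Qed.

End Existence.

(* Main.v *)
(* In the sine basis of K the solution is g_a g_b g_c / (x_a + x_b + x_c), with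
   all eigenvalues x in [1, n^2]. If r is rational of degree k, then
   (1 - r(x) / r(-y)) / (x + y) is a sum of k products of functions of x and of
   y. Hence, up to the relative error Z = sup |r| / inf |r|, the mode-1 fibres
   lie in a k-dimensional space, and by symmetry so do the mode-3 fibres.
   Projecting modes 1 and 3 orthogonally onto that space gives tensor-train
   ranks (1, k, k, 1) and relative error at most sqrt 2 * Z.

   For Z = 4 exp (- pi^2 k / L), L = log (16 gamma), one needs Zolotarev's
   function: after a Moebius change of variable, r is the product of the
   (s - s_j) / (1 - s s_j), s = k sn^2, with nodes s_j equispaced in the argument
   of sn. By the addition theorem each factor is k sn (w + v_j) sn (w - v_j), so
   that r becomes a product of |tanh (u / 2)| over a lattice of step L / k,
   largest halfway between two lattice points. The elliptic functions enter as
   quotients of theta series: the Jacobi triple product is a limit of the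
   q-binomial theorem, the addition theorem comes from splitting a double series
   by parity, and both nome estimates follow from Landen's transformation. *)

Require Import Defs.
From mathcomp Require Import all_boot all_order all_algebra.
From mathcomp Require Import complex.
From mathcomp Require Import all_classical all_reals all_analysis.
From mathcomp Require Import ring lra.
From mathcomp Require Import zify.

Set Implicit Arguments.
Unset Strict Implicit.
Unset Printing Implicit Defensive.

Import Order.TTheory GRing.Theory Num.Theory.
Import numFieldNormedType.Exports.

Local Open Scope classical_set_scope.
Local Open Scope ring_scope.

(** * The q-binomial theorem *)

(** Here gamma = (b + 2)(2b + 1) / (9b), b = n^2, is the cross-ratio of the endpoints of [1, b],
    which holds the eigenvalues, and [-2b, -2], which holds the negated sums of two of them. The 16
    comes from k'^2 <= 16 q', and 4 = 2 * 2 from using sqrt k <= 2 q^(1/4) once on each interval.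
    Both bounds must hold with these exact constants for all n and k, whereas direct estimates of
    the products are lossy; the Landen relation carries them to extreme values of h, where the loss
    disappears. All functions stay on the real line, where Liouville-type arguments on doubly
    periodic functions are out of reach, so identities are proved for finite products and positive
    series and passed to the limit. Separable expansions for modes 1 and 3 cannot be inserted at
    once: the first destroys the Cauchy structure that the second needs. An orthogonal projection
    depends on the space alone and has norm at most one, so the squared errors merely add. The
    kernel error is relative entry by entry, so no norm of the g_a enters. *)

Fixpoint qbinom {R : nzRingType} (q : R) (n k : nat) : R :=
  match n, k with
  | _, 0%N => 1
  | 0%N, _.+1 => 0
  | n'.+1, k'.+1 => qbinom q n' k + q ^+ (n' - k') * qbinom q n' k'
  end.

(** This is the q-Pochhammer symbol (q; q)_n, the q-factorial without its denominator (1 - q)^n. *)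
Definition qfact {R : nzRingType} (q : R) (n : nat) : R :=
  \prod_(i < n) (1 - q ^+ i.+1).

Section QBinomial.
Context {R : comNzRingType}.
Implicit Types (q z : R) (n k : nat).

Lemma qbinom0 q n : qbinom q n 0 = 1. Proof. by case: n. Qed.

Lemma qbinom_small q n k : (n < k)%N -> qbinom q n k = 0.
Proof.
elim: n k => [|n IHn] [|k]//= nk; rewrite !IHn ?mulr0 ?addr0//.
exact: ltnW.
Qed.

Lemma qfactS q n : qfact q n.+1 = qfact q n * (1 - q ^+ n.+1).
Proof. by rewrite /qfact big_ord_recr. Qed.

Lemma qfact0 q : qfact q 0 = 1. Proof. by rewrite /qfact big_ord0. Qed.

Lemma qbinom_qfact q n k : (k <= n)%N ->
  qbinom q n k * (qfact q k * qfact q (n - k)) = qfact q n.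
Proof.
elim: n k => [|n IHn] [|k]//=; rewrite ?qfact0 ?subn0 ?mul1r// ltnS => kn.
rewrite subSS mulrDl.
have [nk|nk] := ltnP k n; last first.
  have -> : k = n by apply/eqP; rewrite eqn_leq kn.
  rewrite qbinom_small// mul0r add0r subnn expr0 mul1r qfactS.
  have := IHn n (leqnn n); rewrite subnn qfact0 !mulr1 => E.
  by rewrite mulrA E.
have E := IHn _ nk; have E' := IHn _ kn; rewrite subnS in E.
have nkE : (n - k = (n - k).-1.+1)%N by rewrite prednK// subn_gt0.
rewrite [in RHS]qfactS.
have -> : qbinom q n k.+1 * (qfact q k.+1 * qfact q (n - k)) =
          qfact q n * (1 - q ^+ (n - k)).
  have D : qfact q (n - k) = qfact q (n - k).-1 * (1 - q ^+ (n - k)).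
    by rewrite [in LHS]nkE qfactS -nkE.
  by rewrite D -E; ring.
have -> : q ^+ (n - k) * qbinom q n k *
    (qfact q k.+1 * qfact q (n - k)) =
    q ^+ (n - k) * (1 - q ^+ k.+1) * qfact q n.
  by rewrite -E' qfactS; ring.
have -> : q ^+ n.+1 = q ^+ (n - k) * q ^+ k.+1.
  by rewrite -exprD addnS subnK.
ring.
Qed.

(** Splitting off the last factor reproduces the q-Pascal recurrence, since q^n = q^(n - k) q^k and
    C(k + 1, 2) = C(k, 2) + k. *)
Lemma q_binomial_theorem q z n :
  \prod_(j < n) (1 + z * q ^+ j) =
  \sum_(k < n.+1) qbinom q n k * q ^+ 'C(k, 2) * z ^+ k.
Proof.
elim: n => [|n IHn]; first by rewrite big_ord0 big_ord1 /= !mulr1.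
rewrite big_ord_recr/= IHn mulrDr mulr1 [RHS]big_ord_recl/=.
rewrite [X in _ = _ + X](_ : _ = \sum_(i < n.+1) (qbinom q n i.+1 * q ^+ 'C(i.+1, 2)
    * z ^+ i.+1) + \sum_(i < n.+1) (qbinom q n i * q ^+ 'C(i, 2) * z ^+ i *
    (z * q ^+ n))); last first.
  rewrite -big_split/=; apply: eq_bigr => i _ /=.
  rewrite mulrDl mulrDl; congr (_ + _).
  have -> : q ^+ n = q ^+ (n - i) * q ^+ i by rewrite -exprD subnK// -ltnS.
  by rewrite binS bin1 exprD [z ^+ i.+1]exprS; ring.
rewrite addrA -mulr_suml; congr (_ + _).
rewrite -[LHS]addr0 [LHS]addrC big_ord_recl/= qbinom0 add0r; congr (_ + _).
by rewrite [RHS]big_ord_recr/= qbinom_small// !mul0r addr0.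
Qed.

End QBinomial.

(** * Theta series *)

Lemma big_iota0 {R : Type} {idx : R} {op : R -> R -> R} n (F : nat -> R) :
  \big[op/idx]_(i <- iota 0 n) F i = \big[op/idx]_(i < n) F i.
Proof. by rewrite -(big_mkord xpredT F) /index_iota subn0. Qed.

Definition zrange (N : nat) : seq int :=
  [seq k%:Z - N%:Z | k <- iota 0 N.*2.+1].

Lemma mem_zrange N (m : int) : (m \in zrange N) = (`|m| <= N)%N.
Proof.
apply/mapP/idP => [[k]|mN].
  rewrite mem_iota => kN ->; move: kN; rewrite -addnn; lia.
exists (absz (m + N%:Z)); last by lia.
by rewrite mem_iota -addnn; lia.
Qed.

Lemma zrange_uniq N : uniq (zrange N).
Proof. by rewrite map_inj_uniq ?iota_uniq// => i j; lia. Qed.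

Lemma big_zrange {R : Type} {idx : R} {op : R -> R -> R} N (F : int -> R) :
  \big[op/idx]_(m <- zrange N) F m =
  \big[op/idx]_(k < N.*2.+1) F (k%:Z - N%:Z).
Proof. by rewrite big_map big_iota0. Qed.

Lemma ler_sum_inj {R : numDomainType} {I J : eqType} (r : seq I) (s : seq J)
    (phi : I -> J) (F : I -> R) (G : J -> R) :
  uniq r -> uniq s -> {in r &, injective phi} ->
  {in r, forall i, phi i \in s} -> (forall j, 0 <= G j) ->
  {in r, forall i, F i = G (phi i)} ->
  \sum_(i <- r) F i <= \sum_(j <- s) G j.
Proof.
move=> ur us phi_inj rs G_ge0 FG.
rewrite (eq_big_seq _ FG).
rewrite -(big_map phi xpredT G) [leRHS](bigID (mem (map phi r)))/=.
rewrite -[X in _ <= X + _]big_filter.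
rewrite (perm_big [seq x <- s | x \in map phi r]); last first.
  apply: uniq_perm; rewrite ?filter_uniq ?map_inj_in_uniq// => j.
  rewrite mem_filter; case: mapP => //= -[i ir ->].
  by rewrite rs.
by rewrite lerDl sumr_ge0.
Qed.

Section ThetaTerms.
Context {R : realType}.
Implicit Types (h w s : R) (N : nat) (m : int).

(** With q = exp (- h) and z = exp w this is q^(m (m - 1) / 2) z^m, the general term of the Jacobi
    triple product. *)
Definition theta_term h w m : R :=
  expR (m%:~R * w - h * (m%:~R * (m%:~R - 1) / 2)).

(** The ratio of the Gaussian binomial [2N, N + m] to the central one [2N, N]. It has this meaning
    for |m| <= N only, as [absz] discards signs. *)
Definition theta_weight h N m : R :=
  qfact (expR (- h)) N ^+ 2 /
  (qfact (expR (- h)) (absz (N%:Z + m)%R) * qfact (expR (- h)) (absz (N%:Z - m)%R)).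

Lemma qfact_gt0 h n : 0 < h -> 0 < qfact (expR (- h)) n.
Proof.
move=> h0; apply: prodr_gt0 => i _; rewrite subr_gt0 exprn_ilt1// ?expR_ge0//.
by rewrite expR_lt1 oppr_lt0.
Qed.

Lemma bin2_natr n : ('C(n, 2))%:R = n%:R * (n%:R - 1) / 2 :> R.
Proof.
have: ('C(n, 2))%:R *+ 2 = n%:R * (n%:R - 1) :> R.
  rewrite -mulrnA muln2 bin2.
  case: n => [|n]; first by rewrite !mul0r.
  have -> : n.+1%:R - 1 = n%:R :> R by rewrite -natr1 addrK.
  rewrite -natrM; congr (_%:R).
  by rewrite mulnC even_halfK// oddM/=; case: odd.
by rewrite -mulr_natr => <-; field.
Qed.

(** The q-binomial theorem with 2N factors, centred by z = s exp (w + N h). The first N factors are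
    turned over by 1 + x = x (1 + 1 / x), and [e] collects the monomials pulled out; s = 1 and s =
    -1 give the two theta products at once. *)
Lemma jacobi_triple_finite h w s N : 0 < h -> s ^+ 2 = 1 ->
  (\prod_(j < N) ((1 + s * expR (w - j%:R * h)) *
                  (1 + s * expR (- w - j.+1%:R * h)))) *
    qfact (expR (- h)) N ^+ 2 =
  qfact (expR (- h)) N.*2 *
  \sum_(m <- zrange N) s ^+ odd (absz m) * (theta_weight h N m * theta_term h w m).
Proof.
move=> h0 s2; set q := expR (- h).
have s0 : s != 0 by rewrite -sqrf_eq0 s2 oner_eq0.
have := q_binomial_theorem q (s * expR (w + N%:R * h)) N.*2.
have spl (G : nat -> R) : \prod_(j < N.*2) G j =
    (\prod_(j < N) G j) * \prod_(j < N) G (N + j)%N.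
  by rewrite -addnn big_split_ord.
rewrite (spl (fun j => 1 + s * expR (w + N%:R * h) * q ^+ j)) {spl}.
set e := s ^+ N * expR (N%:R * w + h * (N%:R * (N%:R + 1) / 2)).
have e0 : e != 0 by rewrite mulf_neq0 ?expf_neq0// gt_eqF ?expR_gt0.
have -> : \prod_(i < N) (1 + s * expR (w + N%:R * h) * q ^+ i) =
    e * \prod_(j < N) (1 + s * expR (- w - j.+1%:R * h)).
  rewrite /e; elim: N {e e0} => [|N IHN].
    by rewrite !big_ord0 !mul0r mulr0 addr0 expR0 !mulr1.
  rewrite big_ord_recl/= big_ord_recr/= (eq_bigr (fun i : 'I_N =>
    1 + s * expR (w + N%:R * h) * q ^+ i)); last first.
    move=> i _; rewrite /bump add1n /q -!expRM_natl -!mulrA -!expRD.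
    by congr (1 + s * expR _); rewrite -!natr1; ring.
  rewrite IHN expr0 mulr1.
  have -> : 1 + s * expR (w + N.+1%:R * h) =
    s * expR (w + N.+1%:R * h) * (1 + s * expR (- w - N.+1%:R * h)).
    rewrite mulrDr mulr1 addrC; congr (_ + _).
    by rewrite mulrACA -expr2 s2 mul1r -expRD -[LHS]expR0; congr expR; ring.
  have -> : expR (N.+1%:R * w + h * (N.+1%:R * (N.+1%:R + 1) / 2)) =
     expR (w + N.+1%:R * h) * expR (N%:R * w + h * (N%:R * (N%:R + 1) / 2)).
    by rewrite -expRD; congr expR; rewrite -!natr1; field.
  by rewrite exprS; ring.
have -> : \prod_(i < N) (1 + s * expR (w + N%:R * h) * q ^+ (N + i)) =
    \prod_(i < N) (1 + s * expR (w - i%:R * h)).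
  apply: eq_bigr => i _; rewrite /q -expRM_natl -mulrA -expRD natrD.
  by congr (1 + s * expR _); ring.
rewrite big_split/= => E.
apply: (mulfI e0).
have key (x y z t : R) : x * (y * z * t) = x * z * y * t by ring.
rewrite key {}E.
rewrite big_zrange !mulr_sumr mulr_suml; apply: eq_bigr => k _.
have kN : (k <= N.*2)%N by rewrite -ltnS.
have -> : qbinom q N.*2 k = qfact q N.*2 / (qfact q k * qfact q (N.*2 - k)).
  by rewrite -(qbinom_qfact _ kN) mulfK// mulf_neq0// gt_eqF// qfact_gt0.
rewrite /theta_weight.
have -> : absz (N%:Z + (k%:Z - N%:Z))%R = k by lia.
have -> : absz (N%:Z - (k%:Z - N%:Z))%R = (N.*2 - k)%N.
  by lia.
have -> : (s * expR (w + N%:R * h)) ^+ k =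
    s ^+ N * s ^+ odd (absz (k%:Z - N%:Z)%R) * expR (k%:R * (w + N%:R * h)).
  rewrite exprMn -expRM_natl; congr (_ * _).
  have s_odd n : s ^+ n = s ^+ odd n.
    rewrite -[in LHS](odd_double_half n) exprD -mul2n exprM s2 expr1n mulr1.
    by case: odd.
  suff -> : odd (absz (k%:Z - N%:Z)%R) = odd (N + k).
    by rewrite -s_odd exprD mulrA -expr2 -exprM mulnC exprM s2 expr1n mul1r.
  have [kN'|kN'] := leqP N k.
    have -> : absz (k%:Z - N%:Z)%R = (k - N)%N by lia.
    by rewrite oddB// oddD addbC.
  have -> : absz (k%:Z - N%:Z)%R = (N - k)%N by lia.
  by rewrite oddB 1?ltnW// oddD.
have -> : q ^+ 'C(k, 2) = expR (- (h * (k%:R * (k%:R - 1) / 2))).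
  by rewrite /q -expRM_natl bin2_natr; congr expR; ring.
rewrite /e /theta_term.
have E : expR (- (h * (k%:R * (k%:R - 1) / 2))) * expR (k%:R * (w + N%:R * h)) =
  expR (N%:R * w + h * (N%:R * (N%:R + 1) / 2)) *
  expR ((k%:Z - N%:Z)%:~R * w - h * ((k%:Z - N%:Z)%:~R * ((k%:Z - N%:Z)%:~R - 1) / 2)).
  by rewrite -!expRD; congr expR; rewrite intrB; field.
have key2 (F I q1 x1 x2 x3 t u D : R) : q1 * x1 = x2 * x3 ->
    F * I * q1 * (t * u * x1) * D = t * x2 * (F * (u * (D * I * x3))).
  move=> H; transitivity (F * I * t * u * D * (q1 * x1)); first by ring.
  by rewrite H; ring.
exact: key2 E.
Qed.

End ThetaTerms.

Lemma cvgn_mul_eq {R : realType} (f g : nat -> R) (a b c : R) :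
  f n @[n --> \oo] --> a -> g n @[n --> \oo] --> b -> a * b = c ->
  f n * g n @[n --> \oo] --> c.
Proof. by move=> fa gb <-; exact: cvgM. Qed.

Lemma cvgn_div_eq {R : realType} (f g : nat -> R) (a b c : R) :
  f n @[n --> \oo] --> a -> g n @[n --> \oo] --> b -> b != 0 -> a / b = c ->
  f n / g n @[n --> \oo] --> c.
Proof. by move=> fa gb b0 <-; apply: cvgM => //; exact: cvgV. Qed.

(** Dominated convergence for series: the weighted sum is caught between its part over a fixed
    window and the unweighted limit. *)
Lemma tannery_int {R : realType} (W : nat -> int -> R) (g : int -> R)
    (P : pred int) (l : R) :
  (forall N m, m \in zrange N -> 0 <= W N m <= 1) ->
  (forall m, W N m @[N --> \oo] --> (1 : R)) ->
  (forall m, 0 <= g m) ->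
  \sum_(m <- zrange N | P m) g m @[N --> \oo] --> l ->
  \sum_(m <- zrange N | P m) W N m * g m @[N --> \oo] --> l.
Proof.
move=> W01 W1 g0 gl.
have sub K N : (K <= N)%N -> {subset zrange K <= zrange N}.
  by move=> KN m; rewrite !mem_zrange => /leq_trans; apply.
have mono (G : int -> R) K N : (K <= N)%N ->
    (forall m, m \in zrange N -> 0 <= G m) ->
    \sum_(m <- zrange K | P m) G m <= \sum_(m <- zrange N | P m) G m.
  move=> KN G0; rewrite big_mkcond [leRHS]big_mkcond/=.
  rewrite [leRHS](big_seq) [leLHS]big_seq/=.
  rewrite [leRHS]big_mkcond [leLHS]big_mkcond/=.
  pose H m := if m \in zrange N then if P m then G m else 0 else 0.
  apply: (@le_trans _ _ (\sum_(i <- zrange K) H i)).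
    rewrite le_eqVlt; apply/orP; left; apply/eqP.
    apply: eq_big_seq => m mK; by rewrite mK /H (sub _ _ KN _ mK).
  rewrite [leRHS](eq_bigr H) => [|m _]; last by rewrite /H.
  apply: (@ler_sum_inj _ _ _ _ _ id); rewrite ?zrange_uniq// => m.
    exact: sub.
  by rewrite /H; case: ifP => // mN; case: ifP => // _; exact: G0.
have nd : nondecreasing_seq (fun N => \sum_(m <- zrange N | P m) g m).
  by move=> K N KN; exact: mono.
have gle N : \sum_(m <- zrange N | P m) g m <= l.
  by have /cvg_lim <- := gl => //; apply: nondecreasing_cvgn_le => //; apply: cvgP gl.
apply/cvgrPdist_le => e e0.
have e20 : 0 < e / 2 by rewrite divr_gt0.
have [K _ /(_ K (leqnn K)) HK] : \forall N \near \oo, `|l - \sum_(m <- zrange N | P m) g m| <= e / 2.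
  by move/cvgrPdist_le : gl => /(_ _ e20).
have WK : \sum_(m <- zrange K | P m) W N m * g m @[N --> \oo] -->
    \sum_(m <- zrange K | P m) g m.
  apply: cvg_big => [|m _]; first exact: add_continuous.
  rewrite -[X in _ --> X]mul1r.
  by apply: cvgM; [exact: W1|exact: cvg_cst].
near=> N.
have KN : (K <= N)%N by near: N; exact: nbhs_infty_ge.
have H1 : \sum_(m <- zrange N | P m) W N m * g m <= l.
  apply: le_trans (gle N); rewrite big_seq_cond [leRHS]big_seq_cond.
  apply: ler_sum => m /andP[mN _]; rewrite ler_piMl//.
  by have /andP[] := W01 _ _ mN.
have H2 : \sum_(m <- zrange K | P m) W N m * g m <=
          \sum_(m <- zrange N | P m) W N m * g m.
  apply: (mono (fun m => W N m * g m)) => // m mN; rewrite mulr_ge0//.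
  by have /andP[] := W01 _ _ mN.
have H3 : `|\sum_(m <- zrange K | P m) g m - \sum_(m <- zrange K | P m) W N m * g m| <= e / 2.
  by near: N; move/cvgrPdist_le : WK; exact.
rewrite ger0_norm ?subr_ge0//.
move: HK H3; rewrite !ler_norml => /andP[_ HK] /andP[_ H3].
by lra.
Unshelve. all: by end_near. Qed.

Section ThetaFunction.
Context {R : realType}.
Implicit Types (h w v : R) (N : nat) (m : int).

Local Notation D h := (qfact (expR (- h))).

(** The ratios 1 - q^(n + 1) of consecutive values increase with n. For Gaussian binomials this says
    that the central one is the largest, so that theta weights are at most 1. *)
Lemma qfact_log_concave h N i : 0 < h -> (i <= N)%N ->
  D h N ^+ 2 <= D h (N + i) * D h (N - i).
Proof.
move=> h0; elim: i => [|i IHi] iN; first by rewrite addn0 subn0 expr2.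
apply: (le_trans (IHi (ltnW iN))).
have -> : (N - i = (N - i.+1).+1)%N by rewrite subnSK.
rewrite addnS !qfactS -!mulrA ler_wpM2l ?(ltW (qfact_gt0 _ h0))// mulrC.
rewrite ler_wpM2r ?(ltW (qfact_gt0 _ h0))// lerB// ler_wiXn2l ?expR_ge0//.
  by rewrite ltW// expR_lt1 oppr_lt0.
by lia.
Qed.

Lemma theta_weight_bounds h N m : 0 < h -> m \in zrange N ->
  0 <= theta_weight h N m <= 1.
Proof.
move=> h0; rewrite mem_zrange => mN.
rewrite divr_ge0 ?mulr_ge0 ?exprn_ge0 ?(ltW (qfact_gt0 _ h0))//=.
rewrite ler_pdivrMr ?mulr_gt0 ?qfact_gt0// mul1r.
case: m mN => m mN.
  have -> : absz (N%:Z + m%:Z)%R = (N + m)%N by lia.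
  have -> : absz (N%:Z - m%:Z)%R = (N - m)%N by lia.
  exact: qfact_log_concave.
have -> : absz (N%:Z + Negz m)%R = (N - m.+1)%N by lia.
have -> : absz (N%:Z - Negz m)%R = (N + m.+1)%N by lia.
by rewrite [leRHS]mulrC; exact: qfact_log_concave.
Qed.

Lemma cvg_expRN_pow h : 0 < h -> expR (- h) ^+ n @[n --> \oo] --> (0 : R).
Proof.
move=> h0; apply: cvg_expr; rewrite ger0_norm ?expR_ge0//.
by rewrite expR_lt1 oppr_lt0.
Qed.

(** Ratios suffice: the infinite product (q; q)_oo cancels from every quotient of theta products. *)
Lemma cvg_qfact_ratio h i : 0 < h ->
  D h (N + i) / D h N @[N --> \oo] --> (1 : R).
Proof.
move=> h0; elim: i => [|i IHi].
  apply: cvg_near_cst; near=> N.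
  by rewrite addn0 divff// gt_eqF// qfact_gt0.
have qi : 1 - expR (- h) ^+ (N + i.+1) @[N --> \oo] --> (1 - 0 : R).
  apply: cvgB; first exact: cvg_cst.
  by have := cvg_expRN_pow h0; rewrite -(cvg_shiftn i.+1).
have -> : (fun N => D h (N + i.+1) / D h N) =
    (fun N => D h (N + i) / D h N * (1 - expR (- h) ^+ (N + i.+1))).
  by apply/funext => N; rewrite addnS qfactS; ring.
by apply: (cvgn_mul_eq IHi qi); rewrite subr0 mulr1.
Unshelve. all: by end_near. Qed.

Lemma cvg_theta_weight h m : 0 < h ->
  theta_weight h N m @[N --> \oo] --> (1 : R).
Proof.
move=> h0.
have H i : D h N ^+ 2 / (D h (N + i) * D h (N - i)) @[N --> \oo] --> (1 : R).
  rewrite -(cvg_shiftn i).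
  have -> : (fun N => D h (N + i) ^+ 2 / (D h (N + i + i) * D h (N + i - i))) =
     (fun N => (D h (N + i) / D h N) / (D h (N + i + i) / D h (N + i))).
    apply/funext => N; rewrite addnK; field.
    by rewrite !gt_eqF ?qfact_gt0.
  apply: (@cvgn_div_eq _ _ _ 1 1); rewrite ?divr1//; first exact: cvg_qfact_ratio.
  by have := cvg_qfact_ratio i h0; rewrite -(cvg_shiftn i).
case: m => m.
  apply: cvg_trans (H m); apply: near_eq_cvg; near=> N.
  have mN : (m <= N)%N by near: N; exact: nbhs_infty_ge.
  rewrite /theta_weight.
  have -> : absz (N%:Z + m%:Z)%R = (N + m)%N by lia.
  by have -> : absz (N%:Z - m%:Z)%R = (N - m)%N by lia.
apply: cvg_trans (H m.+1); apply: near_eq_cvg; near=> N.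
have mN : (m.+1 <= N)%N by near: N; exact: nbhs_infty_ge.
rewrite /theta_weight.
have -> : absz (N%:Z + Negz m)%R = (N - m.+1)%N by lia.
have -> : absz (N%:Z - Negz m)%R = (N + m.+1)%N by lia.
by congr (_ / _); rewrite mulrC.
Unshelve. all: by end_near. Qed.

End ThetaFunction.

Lemma mul_sub_geometric {R : comNzRingType} (q : R) N :
  (1 - q) * \sum_(j < N) q ^+ j = 1 - q ^+ N.
Proof.
have := subrXX 1 q N; rewrite expr1n => ->; congr (_ * _).
by apply: eq_bigr => i _; rewrite expr1n mul1r.
Qed.

Lemma geometric_le {R : realFieldType} (q : R) N : 0 < q < 1 ->
  \sum_(j < N) q ^+ j <= (1 - q)^-1.
Proof.
move=> /andP[q0 q1]; rewrite -[leRHS]div1r ler_pdivlMr ?subr_gt0// mulrC.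
by rewrite mul_sub_geometric lerBlDr lerDl exprn_ge0// ltW.
Qed.

Definition tau {R : realType} (u : R) : R := `|1 - expR u| / (1 + expR u).

(** The window of 2N shifts, from -(N - 1) h to N h, is that of the finite triple product; the
    shifted points are symmetric about 0 for w = - h / 2. *)
Definition tau_prod {R : realType} (h : R) (N : nat) (w : R) : R :=
  \prod_(j < N) (tau (w - j%:R * h) * tau (w + j.+1%:R * h)).

Definition theta_sum {R : realType} (h w : R) (P : pred int) (N : nat) : R :=
  \sum_(m <- zrange N | P m) theta_term h w m.

Definition theta {R : realType} (h w : R) (P : pred int) : R :=
  limn (theta_sum h w P).

Definition has_parity (b : bool) : pred int := fun m => odd (absz m) == b.

(** The numerator is the theta series with signs (-1)^m; the two parities are kept apart so that
    every series has nonnegative terms. *)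
Definition theta_quot {R : realType} (h w : R) : R :=
  (theta h w (has_parity false) - theta h w (has_parity true)) /
  (theta h w (has_parity false) + theta h w (has_parity true)).

Section ThetaLimits.
Context {R : realType}.
Implicit Types (h w v u s : R) (N : nat) (m : int) (P : pred int).

Local Notation D h := (qfact (expR (- h))).

Lemma tauN u : tau (- u) = tau u.
Proof.
rewrite /tau expRN; have e0 := expR_gt0 u.
have -> : 1 - (expR u)^-1 = (expR u - 1) / expR u by field; rewrite gt_eqF.
have -> : 1 + (expR u)^-1 = (expR u + 1) / expR u by field; rewrite gt_eqF.
rewrite normrM normfV (ger0_norm (ltW e0)) distrC (addrC (expR u) 1).
by field; rewrite !gt_eqF// addr_gt0.
Qed.

Lemma zrange_sum_le (G : int -> R) P K N : (forall m, 0 <= G m) -> (K <= N)%N ->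
  \sum_(m <- zrange K | P m) G m <= \sum_(m <- zrange N | P m) G m.
Proof.
move=> G0 KN; rewrite -big_filter -[leRHS]big_filter.
apply: (@ler_sum_inj _ _ _ _ _ id);
  rewrite ?filter_uniq ?zrange_uniq// => m; rewrite !mem_filter !mem_zrange.
by case/andP=> -> /leq_trans; apply.
Qed.

Lemma theta_term_ge0 h w m : 0 <= theta_term h w m.
Proof. exact: expR_ge0. Qed.

Lemma theta_product_le h w N : 0 < h ->
  \prod_(j < N) ((1 + expR (w - j%:R * h)) * (1 + expR (- w - j.+1%:R * h))) <=
  expR ((expR w + expR (- w)) / (1 - expR (- h))).
Proof.
move=> h0; set q := expR (- h).
have q1 : q < 1 by rewrite expR_lt1 oppr_lt0.
have q0 : 0 < q by exact: expR_gt0.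
apply: (@le_trans _ _ (\prod_(j < N) expR ((expR w + expR (- w)) * q ^+ j))).
  apply: ler_prod => j _; rewrite mulr_ge0 ?addr_ge0 ?expR_ge0//= [in leRHS]mulrDl [in leRHS]expRD.
  have qE k : q ^+ k = expR (- (k%:R * h)) by rewrite -expRM_natl mulrN.
  apply: ler_pM; rewrite ?addr_ge0 ?expR_ge0//.
    by apply: le_trans (expR_ge1Dx _); rewrite lerD2l qE -expRD.
  apply: le_trans (expR_ge1Dx _); rewrite lerD2l qE -expRD ler_expR.
  by rewrite lerD2l lerN2 ler_wpM2r ?ler_nat// ltW.
rewrite -expR_sum ler_expR -mulr_sumr ler_wpM2l ?addr_ge0 ?expR_ge0//.
by rewrite geometric_le// q0.
Qed.

(** Summability comes from the triple product itself: for fixed K the weighted sum is at most a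
    finite product, bounded uniformly in N, and the weights tend to 1. *)
Lemma theta_sum_bounded h w P K : 0 < h ->
  theta_sum h w P K <= expR ((expR w + expR (- w)) / (1 - expR (- h))).
Proof.
move=> h0; set C := (X in _ <= X).
apply: (@le_trans _ _ (theta_sum h w xpredT K)).
  rewrite /theta_sum big_mkcond/= ler_sum// => m _.
  by case: ifP => // _; exact: theta_term_ge0.
have WN N : (K <= N)%N ->
    \sum_(m <- zrange K) theta_weight h N m * theta_term h w m <= C.
  move=> KN.
  have W0 m : m \in zrange N -> 0 <= theta_weight h N m.
    by move=> mN; have /andP[] := theta_weight_bounds h0 mN.
  apply: (@le_trans _ _ (\sum_(m <- zrange N) theta_weight h N m * theta_term h w m)).
    rewrite big_seq [leRHS]big_seq -big_filter -[leRHS]big_filter.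
    apply: (@ler_sum_inj _ _ _ _ _ id (fun m => theta_weight h N m * theta_term h w m)
       (fun m => theta_weight h N m * theta_term h w m)) => //;
      rewrite ?filter_uniq ?zrange_uniq// => m.
      rewrite !mem_filter !mem_zrange => /andP[_ mK].
      by rewrite andbb (leq_trans mK).
    by rewrite mulr_ge0// ?theta_term_ge0// divr_ge0 ?mulr_ge0 ?exprn_ge0 ?(ltW (qfact_gt0 _ h0)).
  have := jacobi_triple_finite w N h0 (expr1n R 2).
  under eq_bigr do rewrite !mul1r.
  under [in RHS]eq_bigr do rewrite expr1n mul1r.
  move=> E; have D0 := qfact_gt0 N.*2 h0; have DN := qfact_gt0 N h0.
  rewrite -(ler_pM2l D0) -E mulrC.
  have : D h N ^+ 2 <= D h N.*2.
    have := @qfact_log_concave R h N N h0 (leqnn N).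
    by rewrite subnn qfact0 mulr1 addnn.
  move=> DD; apply: ler_pM => //; rewrite ?exprn_ge0 ?(ltW DN)//.
    by apply: prodr_ge0 => j _; rewrite mulr_ge0 ?addr_ge0 ?expR_ge0.
  exact: theta_product_le.
have cW : \sum_(m <- zrange K) theta_weight h N m * theta_term h w m
    @[N --> \oo] --> \sum_(m <- zrange K) theta_term h w m.
  apply: cvg_big => [|m _]; first exact: add_continuous.
  apply: (@cvgn_mul_eq _ _ _ 1 (theta_term h w m)); rewrite ?mul1r//.
    exact: cvg_theta_weight.
  exact: cvg_cst.
rewrite /theta_sum -(cvg_lim _ cW)//; apply: limr_le; first exact: cvgP cW.
by near=> N; apply: WN; near: N; exact: nbhs_infty_ge.
Unshelve. all: by end_near. Qed.

Lemma cvg_theta_sum h w P : 0 < h ->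
  theta_sum h w P N @[N --> \oo] --> theta h w P.
Proof.
move=> h0; apply: nondecreasing_is_cvgn.
  by move=> K N KN; apply: zrange_sum_le => // m; exact: theta_term_ge0.
exists (expR ((expR w + expR (- w)) / (1 - expR (- h)))) => _ [N _ <-].
exact: theta_sum_bounded.
Qed.

Lemma theta_sum_le_theta h w P N : 0 < h -> theta_sum h w P N <= theta h w P.
Proof.
move=> h0; apply: nondecreasing_cvgn_le; last by apply: cvgP; exact: cvg_theta_sum.
by move=> K M KM; apply: zrange_sum_le => // m; exact: theta_term_ge0.
Qed.

Lemma theta_gt0 h w P : 0 < h -> P 0 -> 0 < theta h w P.
Proof.
move=> h0 P0; apply: lt_le_trans (theta_sum_le_theta w P 0 h0).
rewrite /theta_sum /zrange/= big_cons big_nil P0 addr0 expR_gt0//.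
Qed.

Lemma theta_ge0 h w P : 0 < h -> 0 <= theta h w P.
Proof.
move=> h0; apply: le_trans (theta_sum_le_theta w P 0 h0).
by rewrite sumr_ge0// => m _; exact: theta_term_ge0.
Qed.

Lemma theta_parity_gt0 h w : 0 < h ->
  0 < theta h w (has_parity false) + theta h w (has_parity true).
Proof. by move=> h0; rewrite ltr_wpDr ?theta_ge0// theta_gt0. Qed.

(* [tau] is [|tanh (u / 2)|], and the product over the lattice [h Z] of its
   translates is a quotient of two theta products, evaluated by the Jacobi
   triple product. *)
Lemma cvg_tau_prod h w : 0 < h ->
  tau_prod h N w @[N --> \oo] --> `|theta_quot h w|.
Proof.
move=> h0.
pose A b N := \sum_(m <- zrange N | has_parity b m)
  theta_weight h N m * theta_term h w m.
have cA b : A b N @[N --> \oo] --> theta h w (has_parity b).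
  apply: tannery_int => [N m mN|m|m|].
  - exact: theta_weight_bounds.
  - exact: cvg_theta_weight.
  - exact: theta_term_ge0.
  - exact: cvg_theta_sum.
have AN s N : s ^+ 2 = 1 ->
  \prod_(j < N) ((1 + s * expR (w - j%:R * h)) * (1 + s * expR (- w - j.+1%:R * h)))
    * D h N ^+ 2 = D h N.*2 * (A false N + s * A true N).
  move=> s2; rewrite jacobi_triple_finite//; congr (_ * _).
  rewrite (bigID (has_parity false))/=; congr (_ + _).
    by apply: eq_bigr => m /eqP ->; rewrite mul1r.
  rewrite /A mulr_sumr; apply: eq_big => m; rewrite /has_parity.
    by case: odd.
  by case: odd => // _; rewrite expr1.
have E N : tau_prod h N w = `|A false N - A true N| / (A false N + A true N).
  have Dpos : 0 < D h N ^+ 2 by rewrite exprn_gt0// qfact_gt0.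
  have D2pos : 0 < D h N.*2 by exact: qfact_gt0.
  have H1 := AN 1 N (expr1n _ 2); have H2 := AN (-1) N (sqrr_sign _ 1).
  rewrite !mul1r mulN1r in H1 H2.
  rewrite -(mulfK (lt0r_neq0 D2pos) (A false N - A true N)).
  rewrite -(mulfK (lt0r_neq0 D2pos) (A false N + A true N)).
  rewrite ![_ * D h N.*2]mulrC -H1 -H2 normrM normfV normrM.
  rewrite (gtr0_norm Dpos) (gtr0_norm D2pos).
  under [in RHS]eq_bigr do rewrite !mulN1r.
  rewrite normr_prod.
  set X := \prod_(i < N) `|_|; set Y := \prod_(i < N) _.
  have Y0 : 0 < Y.
    by apply: prodr_gt0 => j _; rewrite !mul1r mulr_gt0// addr_gt0 ?expR_gt0.
  have -> : X * D h N ^+ 2 / D h N.*2 / (Y * D h N ^+ 2 / D h N.*2) = X / Y.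
    by field; rewrite !gt_eqF ?qfact_gt0.
  rewrite /X /Y -prodf_div; apply: eq_bigr => j _.
  rewrite -(tauN (w + j.+1%:R * h)) opprD /tau normrM !mul1r.
  by field; rewrite !gt_eqF// addr_gt0 ?expR_gt0.
rewrite (_ : tau_prod h ^~ w = fun N => `|A false N - A true N| / (A false N + A true N)).
  rewrite /theta_quot normrM normfV (gtr0_norm (theta_parity_gt0 _ h0)).
  apply: (@cvgn_div_eq _ _ _ `|theta h w (has_parity false) - theta h w (has_parity true)|
    (theta h w (has_parity false) + theta h w (has_parity true))) => //.
  - by apply: cvg_norm; apply: cvgB.
  - by apply: cvgD.
  - by rewrite gt_eqF// theta_parity_gt0.
exact/funext.
Qed.

End ThetaLimits.

(** * The addition theorem *)

Section ThetaAddition.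
Context {R : realType}.
Implicit Types (h w v u s : R) (N : nat) (m : int) (P : pred int) (b : bool).

Let box N : seq (int * int) := [seq (m, n) | m <- zrange N, n <- zrange N].

Let parity b (p : int * int) := odd (absz p.1) (+) odd (absz p.2) == b.

(** A bijection from Z^2 onto the pairs whose sum has parity b. It turns m^2 + n^2 into 2 i^2 + 2
    j^2 up to lower-order terms, so the double series decouples into two theta series of step 2h. *)
Let shear b (p : int * int) : int * int := (p.1 + p.2, p.1 - p.2 + b%:Z).

Let mem_box N p : (p \in box N) = (absz p.1 <= N)%N && (absz p.2 <= N)%N.
Proof.
apply/allpairsP/idP => [[[m n]/= [mN nN ->]]|/andP[p1 p2]].
  by rewrite -!mem_zrange mN nN.
by exists p; rewrite !mem_zrange; split => //; case: p {p1 p2}.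
Qed.

Let box_uniq N : uniq (box N).
Proof. by apply: allpairs_uniq; rewrite ?zrange_uniq// => -[? ?] [? ?]. Qed.

Let shear_inj b : injective (shear b).
Proof.
move=> [i j] [i' j'] [] /= E1 E2.
by congr (_, _); lia.
Qed.

Let shear_parity b p : parity b (shear b p).
Proof. by case: p => i j; apply/eqP; rewrite /=; case: b; lia. Qed.

Let unshear b (p : int * int) : int * int :=
  (((p.1 + p.2 - b%:Z) %/ 2)%Z, ((p.1 - p.2 + b%:Z) %/ 2)%Z).

Let unshearK b p : parity b p -> shear b (unshear b p) = p.
Proof.
case: p => m n /eqP; rewrite /shear /unshear /= => E.
by congr (_, _); case: b E; lia.
Qed.

(** A shear does not map squares to squares, so the partial sums are only nested, in both
    directions; for nonnegative terms this makes the limits agree. *)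
Let shear_sum_le b N (F : int * int -> R) : (forall p, 0 <= F p) ->
  \sum_(p <- box N) F (shear b p) <= \sum_(p <- box N.*2.+1 | parity b p) F p.
Proof.
move=> F0; rewrite -[leRHS]big_filter.
apply: (@ler_sum_inj _ _ _ _ _ (shear b)) => //.
- by rewrite filter_uniq.
- by move=> p q _ _; exact: shear_inj.
- move=> [i j]; rewrite mem_filter shear_parity !mem_box/= => /andP[iN jN].
  by case: b; apply/andP; split; lia.
Qed.

Let sum_le_shear b N (F : int * int -> R) : (forall p, 0 <= F p) ->
  \sum_(p <- box N | parity b p) F p <= \sum_(p <- box N.+1) F (shear b p).
Proof.
move=> F0; rewrite -big_filter.
apply: (@ler_sum_inj _ _ _ _ _ (unshear b)) => //.
- by rewrite filter_uniq.
- move=> p q; rewrite !mem_filter => /andP[Hp _] /andP[Hq _] E.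
  by rewrite -(unshearK Hp) -(unshearK Hq) E.
- move=> [m n]; rewrite mem_filter !mem_box/= => /andP[_ /andP[mN nN]].
  by case: b; apply/andP; split; lia.
- by move=> p; rewrite mem_filter => /andP[Hp _]; rewrite unshearK.
Qed.

Lemma theta_mul h w v b : 0 < h ->
  theta h (w + v) (has_parity false) * theta h (w - v) (has_parity b) +
  theta h (w + v) (has_parity true) * theta h (w - v) (has_parity (~~ b)) =
  expR (if b then w - v else 0) *
  theta (2 * h) (2 * w - (if b then h else 0)) xpredT *
  theta (2 * h) (2 * v - (if b then 0 else h)) xpredT.
Proof.
move=> h0; have h20 : 0 < 2 * h by rewrite mulr_gt0.
pose F (p : int * int) := theta_term h (w + v) p.1 * theta_term h (w - v) p.2.
have F0 p : 0 <= F p by rewrite mulr_ge0 ?theta_term_ge0.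
pose T c := theta h (w + v) (has_parity c).
pose T' c := theta h (w - v) (has_parity c).
have cL : \sum_(p <- box N | parity b p) F p @[N --> \oo] -->
    T false * T' b + T true * T' (~~ b).
  have E N : \sum_(p <- box N | parity b p) F p =
    theta_sum h (w + v) (has_parity false) N * theta_sum h (w - v) (has_parity b) N +
    theta_sum h (w + v) (has_parity true) N * theta_sum h (w - v) (has_parity (~~ b)) N.
    rewrite big_mkcond big_allpairs/= (bigID (has_parity false))/=; congr (_ + _).
      rewrite /theta_sum mulr_suml; apply: eq_bigr => m /eqP Pm.
      rewrite mulr_sumr [RHS]big_mkcond/=; apply: eq_bigr => n _.
      by rewrite /parity/= Pm /has_parity addFb.
    rewrite /theta_sum mulr_suml; apply: eq_big => m; rewrite /has_parity.
      by case: odd.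
    move=> Pm; rewrite mulr_sumr [RHS]big_mkcond/=; apply: eq_bigr => n _.
    rewrite /parity/=; have -> : odd (absz m) by move: Pm; case: odd.
    by rewrite addTb; case: b; case: odd.
  rewrite (_ : (fun N => _) = fun N => theta_sum h (w + v) (has_parity false) N *
    theta_sum h (w - v) (has_parity b) N + theta_sum h (w + v) (has_parity true) N *
    theta_sum h (w - v) (has_parity (~~ b)) N); last exact/funext.
  by apply: cvgD; apply: cvgM; exact: cvg_theta_sum.
set rhs := (X in _ = X).
have cR : \sum_(p <- box N) F (shear b p) @[N --> \oo] --> rhs.
  have E N : \sum_(p <- box N) F (shear b p) =
    expR (if b then w - v else 0) *
    theta_sum (2 * h) (2 * w - (if b then h else 0)) xpredT N *
    theta_sum (2 * h) (2 * v - (if b then 0 else h)) xpredT N.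
    rewrite big_allpairs /theta_sum -mulrA big_distrlr/= mulr_sumr; apply: eq_bigr => i _.
    rewrite mulr_sumr; apply: eq_bigr => j _.
    rewrite /F /theta_term/= -!expRD; congr expR.
    by case: b {cL rhs} => /=; rewrite ?addr0 !(intrD, intrB, intrN)/=; field.
  rewrite (_ : (fun N => _) = fun N => expR (if b then w - v else 0) *
    theta_sum (2 * h) (2 * w - (if b then h else 0)) xpredT N *
    theta_sum (2 * h) (2 * v - (if b then 0 else h)) xpredT N); last exact/funext.
  apply: cvgM; last exact: cvg_theta_sum.
  by apply: cvgM; [exact: cvg_cst|exact: cvg_theta_sum].
apply/eqP; rewrite eq_le; apply/andP; split.
- have cR' : \sum_(p <- box N.+1) F (shear b p) @[N --> \oo] --> rhs.
    by move: cR; rewrite -(cvg_shiftS).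
  rewrite -/(T _) -/(T' _) -(cvg_lim _ cL)// -(cvg_lim _ cR')//.
  apply: ler_lim; [exact: cvgP cL|exact: cvgP cR'|].
  by apply: nearW => N; exact: sum_le_shear.
- have cL' : \sum_(p <- box N.*2.+1 | parity b p) F p @[N --> \oo] -->
      T false * T' b + T true * T' (~~ b).
    apply: (cvg_comp _ _ _ cL) => A [n _ nA]; exists n => // k /= nk.
    by apply: nA => /=; rewrite (leq_trans nk)// -addnn; lia.
  rewrite -/(T _) -/(T' _) -(cvg_lim _ cL')// -(cvg_lim _ cR)//.
  apply: ler_lim; [exact: cvgP cR|exact: cvgP cL'|].
  by apply: nearW => N; exact: shear_sum_le.
Qed.

Let ratio h w := theta (2 * h) (2 * w) xpredT /
                 (expR w * theta (2 * h) (2 * w - h) xpredT).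

Let ratio_gt0 h w : 0 < h -> 0 < ratio h w.
Proof.
by move=> h0; rewrite divr_gt0 ?mulr_gt0 ?expR_gt0 ?theta_gt0 ?mulr_gt0.
Qed.

(** [theta_mul] factors the even and the odd part of the double series, and their quotient is
    [ratio h w / ratio h v]. *)
Let theta_quot_mul h w v : 0 < h ->
  theta_quot h (w + v) * theta_quot h (w - v) =
  (ratio h w - ratio h v) / (ratio h w + ratio h v).
Proof.
move=> h0; have h20 : 0 < 2 * h by rewrite mulr_gt0.
have H0 := theta_mul w v false h0; have H1 := theta_mul w v true h0.
rewrite /= expR0 mul1r !subr0 in H0; rewrite /= subr0 in H1.
rewrite /theta_quot /ratio.
have := theta_parity_gt0 (w + v) h0; have := theta_parity_gt0 (w - v) h0.
have := @theta_gt0 R _ (2 * w) xpredT h20 isT.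
have := @theta_gt0 R _ (2 * v) xpredT h20 isT.
have := @theta_gt0 R _ (2 * w - h) xpredT h20 isT.
have := @theta_gt0 R _ (2 * v - h) xpredT h20 isT.
move: H0 H1; rewrite expRB.
set A := theta h (w + v) _; set B := theta h (w + v) _.
set A' := theta h (w - v) _; set B' := theta h (w - v) _.
set Nw := theta _ (2 * w) _; set Nv := theta _ (2 * v) _.
set Pw := theta _ (2 * w - h) _; set Pv := theta _ (2 * v - h) _.
have := expR_gt0 w; have := expR_gt0 v.
set x := expR w; set y := expR v.
move=> y0 x0 H0 H1 Pv0 Pw0 Nv0 Nw0 AB' AB.
have -> : (A - B) / (A + B) * ((A' - B') / (A' + B')) =
  ((A * A' + B * B') - (A * B' + B * A')) / ((A * A' + B * B') + (A * B' + B * A')).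
  have -> : (A * A' + B * B') + (A * B' + B * A') = (A + B) * (A' + B') by ring.
  by field; rewrite !gt_eqF.
rewrite H0 H1; field.
rewrite !gt_eqF//= ?addr_gt0 ?mulr_gt0//.
Qed.

(* With [theta_quot h w = sqrt k * sn w] this is the addition theorem
   [sn (w + v) sn (w - v) = (sn^2 w - sn^2 v) / (1 - k^2 sn^2 w sn^2 v)]. *)
Lemma theta_quot_addition h w v : 0 < h ->
  theta_quot h (w + v) * theta_quot h (w - v) *
    (1 - theta_quot h w ^+ 2 * theta_quot h v ^+ 2) =
  theta_quot h w ^+ 2 - theta_quot h v ^+ 2.
Proof.
move=> h0.
(* At v = 0 the product formula gives squares, so the addition theorem becomes a rational identity
   in the three values [ratio h w], [ratio h v] and [ratio h 0]. *)
have sq u : theta_quot h u ^+ 2 =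
    (ratio h u - ratio h 0) / (ratio h u + ratio h 0).
  by rewrite -theta_quot_mul// addr0 subr0 expr2.
rewrite theta_quot_mul// !sq.
have := ratio_gt0 w h0; have := ratio_gt0 v h0; have := ratio_gt0 0 h0.
move: (ratio h w) (ratio h v) (ratio h 0) => a b c c0 b0 a0.
by field; rewrite !gt_eqF// addr_gt0.
Qed.

Lemma theta_quot_sqr_lt1 h w : 0 < h -> theta_quot h w ^+ 2 < 1.
Proof.
move=> h0; have -> : theta_quot h w ^+ 2 =
    (ratio h w - ratio h 0) / (ratio h w + ratio h 0).
  by rewrite -theta_quot_mul// addr0 subr0 expr2.
have a0 := ratio_gt0 w h0; have b0 := ratio_gt0 0 h0.
by rewrite ltr_pdivrMr ?addr_gt0// mul1r; lra.
Qed.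

End ThetaAddition.

(** * The function sqrt k * sn *)

Definition snk {R : realType} (h w : R) : R := `|theta_quot h w|.

(** This is sqrt k: sn takes the value 1 at its quarter period, here h / 2 because the zeros are the
    lattice h Z. *)
Definition snk_max {R : realType} (h : R) : R := snk h (h / 2).

Lemma ler_prod_sub {R : numDomainType} {I : eqType} (r s : seq I) (g : I -> R) :
  (forall i, 0 <= g i <= 1) -> uniq s -> {subset s <= r} ->
  \prod_(i <- r) g i <= \prod_(i <- s) g i.
Proof.
move=> g01; elim: s r => [|x s IHs] r /=.
  move=> _ _; rewrite big_nil.
  by apply: prodr_ile1 => i _; exact: g01.
case/andP=> xs us sr.
have xr : x \in r by rewrite sr// mem_head.
rewrite (perm_big _ (perm_to_rem xr)) !big_cons /=.
have /andP[g0 _] := g01 x; rewrite ler_wpM2l// IHs// => y ys.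
have yr : y \in r by rewrite sr// in_cons ys orbT.
rewrite (perm_mem (perm_to_rem xr)) in_cons in yr.
by case/orP: yr => // /eqP yx; rewrite -yx ys in xs.
Qed.

Section Snk.
Context {R : realType}.
Implicit Types (h w v u d : R) (N k : nat).

Lemma tau_ge0 u : 0 <= tau u.
Proof. by rewrite divr_ge0// addr_ge0// expR_ge0. Qed.

Lemma tau_le1 u : tau u <= 1.
Proof.
rewrite ler_pdivrMr ?addr_gt0 ?expR_gt0// mul1r ler_norml.
by have := expR_gt0 u; lra.
Qed.

Lemma tau_le_norm u : tau u <= `|u|.
Proof.
wlog u0 : u / u <= 0.
  move=> H; have [/H//|/ltW u0] := leP u 0.
  by rewrite -tauN -normrN H// oppr_le0.
have e1 := expR_ge1Dx u; have e0 := expR_gt0 u.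
have e2 : expR u <= 1 by rewrite -expR0 ler_expR.
rewrite (ler0_norm u0) ler_pdivrMr ?addr_gt0// ger0_norm ?subr_ge0//.
by rewrite mulrDr mulr1; nra.
Qed.

(** The midpoint of two lattice points is extremal: with a = exp d and b = exp u, the
    cross-multiplied difference is 2 a (1 + a^2) (b - 1)^2. *)
Lemma tau_pair_le u d : `|u| <= d -> tau (u + d) * tau (u - d) <= tau d ^+ 2.
Proof.
rewrite ler_norml => /andP[ud du].
rewrite -(tauN (u - d)) opprB addrC /tau !expRD expRN.
set a := expR d; set b := expR u.
have a0 : 0 < a := expR_gt0 d; have b0 : 0 < b := expR_gt0 u.
have ab : 1 <= a * b by rewrite -expRD -expR0 ler_expR; lra.
have ba : b <= a by rewrite ler_expR.
rewrite (ler0_norm (x := 1 - a * b)) ?subr_le0//.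
rewrite (ler0_norm (x := 1 - a / b)) ?subr_le0 ?ler_pdivlMr ?mul1r//.
rewrite expr_div_n real_normK ?num_real//.
have -> : - (1 - a * b) / (1 + a * b) * (- (1 - a / b) / (1 + a / b)) =
  (a * b - 1) * (a - b) / ((1 + a * b) * (a + b)).
  by field; rewrite !gt_eqF// ?addr_gt0 ?mulr_gt0.
rewrite ler_pdivrMr ?mulr_gt0 ?addr_gt0 ?mulr_gt0// mulrAC.
rewrite ler_pdivlMr ?exprn_gt0 ?addr_gt0//.
rewrite -subr_ge0.
have -> : (1 - a) ^+ 2 * ((1 + a * b) * (a + b)) -
  (a * b - 1) * (a - b) * (1 + a) ^+ 2 = 2 * a * (1 + a ^+ 2) * (b - 1) ^+ 2.
  by ring.
apply: mulr_ge0; last exact: sqr_ge0.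
by rewrite !mulr_ge0 ?(ltW a0)// addr_ge0// sqr_ge0.
Qed.

Lemma tau_prod_ge0 h N w : 0 <= tau_prod h N w.
Proof. by apply: prodr_ge0 => j _; rewrite mulr_ge0 ?tau_ge0. Qed.

Lemma tau_prod_half h N :
  tau_prod h N (- (h / 2)) = \prod_(l < N) tau ((l%:R + 1 / 2) * h) ^+ 2.
Proof.
apply: eq_bigr => l _; rewrite expr2; congr (_ * _).
  by rewrite -tauN; congr tau; field.
by congr tau; rewrite -natr1; field.
Qed.

Lemma snk_ge0 h w : 0 <= snk h w. Proof. exact: normr_ge0. Qed.

Lemma cvg_snk h w : 0 < h -> tau_prod h N w @[N --> \oo] --> snk h w.
Proof. exact: cvg_tau_prod. Qed.

Lemma snk_lt1 h w : 0 < h -> snk h w < 1.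
Proof.
move=> h0; have := theta_quot_sqr_lt1 w h0.
by rewrite -(real_normK (num_real _)) expr_lt1// normr_ge0.
Qed.

Lemma tau_prod_nonincreasing h w : nonincreasing_seq (tau_prod h ^~ w).
Proof.
apply/nonincreasing_seqP => N; rewrite /tau_prod big_ord_recr/=.
by rewrite ler_piMr ?tau_prod_ge0// mulr_ile1 ?tau_ge0 ?tau_le1.
Qed.

Lemma snk_le_tau_prod h w N : 0 < h -> snk h w <= tau_prod h N w.
Proof.
move=> h0; rewrite -(cvg_lim _ (@cvg_snk h w h0))//.
apply: nonincreasing_cvgn_ge; first exact: tau_prod_nonincreasing.
by apply: cvgP; exact: cvg_snk.
Qed.

Lemma snk_le_tau h w : 0 < h -> snk h w <= tau w.
Proof.
move=> h0; apply: le_trans (snk_le_tau_prod w 1 h0) _.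
by rewrite /tau_prod big_ord1 mul0r subr0 ler_piMr ?tau_ge0 ?tau_le1.
Qed.

Lemma cvg_tau_shift w h : 0 < h ->
  tau (w + N%:R * h) @[N --> \oo] --> (1 : R).
Proof.
move=> h0.
have cE : expR (- w) * expR (- h) ^+ N @[N --> \oo] --> (0 : R).
  by apply: (cvgn_mul_eq (cvg_cst _) (cvg_expRN_pow h0)); rewrite mulr0.
have -> : (fun N => tau (w + N%:R * h)) =
    (fun N => `|1 - expR (- w) * expR (- h) ^+ N| / (1 + expR (- w) * expR (- h) ^+ N)).
  apply/funext => N; rewrite -tauN /tau -expRM_natl -expRD.
  by rewrite opprD mulrN.
apply: (@cvgn_div_eq _ _ _ 1 1) => //; last by rewrite divr1.
  rewrite -[in X in _ --> X](normr1 R) -[X in `|X|](subr0 1).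
  by apply: cvg_norm; apply: cvgB => //; exact: cvg_cst.
rewrite -[X in _ --> X](addr0 1).
by apply: cvgD => //; exact: cvg_cst.
Qed.

(** Moving the window by one step exchanges only its end factors, and these tend to 1. *)
Lemma snkD h w : 0 < h -> snk h (w + h) = snk h w.
Proof.
move=> h0.
have E N : tau_prod h N (w + h) * tau (w - N%:R * h + h) =
           tau_prod h N w * tau (w + N%:R * h + h).
  elim: N => [|N IHN]; first by rewrite /tau_prod !big_ord0 mul0r subr0 addr0.
  rewrite {1}/tau_prod big_ord_recr/= -/(tau_prod _ _ _).
  rewrite [in RHS]/tau_prod big_ord_recr/= -/(tau_prod _ _ _).
  have -> : w + h - N%:R * h = w - N%:R * h + h by ring.
  have -> : w + N.+1%:R * h = w + N%:R * h + h by rewrite -natr1; ring.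
  have -> : w - N.+1%:R * h + h = w - N%:R * h by rewrite -natr1; ring.
  have -> : w + h + N.+1%:R * h = w + N%:R * h + h + h by rewrite -natr1; ring.
  transitivity (tau_prod h N (w + h) * tau (w - N%:R * h + h) *
    (tau (w + N%:R * h + h + h) * tau (w - N%:R * h))); first by ring.
  by rewrite IHN; ring.
have c1 : tau (w - N%:R * h + h) @[N --> \oo] --> (1 : R).
  have -> : (fun N => tau (w - N%:R * h + h)) = (fun N => tau (- (w + h) + N%:R * h)).
    by apply/funext => N; rewrite -tauN; congr tau; ring.
  exact: cvg_tau_shift.
have c2 : tau (w + N%:R * h + h) @[N --> \oo] --> (1 : R).
  have -> : (fun N => tau (w + N%:R * h + h)) = (fun N => tau ((w + h) + N%:R * h)).
    by apply/funext => N; congr tau; ring.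
  exact: cvg_tau_shift.
have L1 := cvgn_mul_eq (@cvg_snk h (w + h) h0) c1 (mulr1 _).
have L2 := cvgn_mul_eq (@cvg_snk h w h0) c2 (mulr1 _).
rewrite (funext E) in L1.
exact: (cvg_unique _ L1 L2).
Qed.

Lemma snkN h w : 0 < h -> snk h (- w) = snk h w.
Proof.
move=> h0; have E N : tau_prod h N (- w) * tau (w + N%:R * h) =
           tau_prod h N w * tau (w - N%:R * h).
  elim: N => [|N IHN]; first by rewrite /tau_prod !big_ord0 mul0r subr0 addr0.
  rewrite {1}/tau_prod big_ord_recr/= -/(tau_prod _ _ _).
  rewrite [in RHS]/tau_prod big_ord_recr/= -/(tau_prod _ _ _).
  rewrite -(tauN (- w - _)) -(tauN (- w + _)) !opprD !opprK.
  transitivity (tau_prod h N (- w) * tau (w + N%:R * h) *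
    (tau (w - N.+1%:R * h) * tau (w + N.+1%:R * h))); first by ring.
  by rewrite IHN; ring.
have c1 : tau (w - N%:R * h) @[N --> \oo] --> (1 : R).
  have -> : (fun N => tau (w - N%:R * h)) = (fun N => tau (- w + N%:R * h)).
    by apply/funext => N; rewrite -tauN; congr tau; ring.
  exact: cvg_tau_shift.
have L1 := cvgn_mul_eq (@cvg_snk h (- w) h0) (@cvg_tau_shift w h h0) (mulr1 _).
have L2 := cvgn_mul_eq (@cvg_snk h w h0) c1 (mulr1 _).
rewrite (funext E) in L1.
exact: (cvg_unique _ L1 L2).
Qed.

(** The lattice h Z is the union of 2h Z and h + 2h Z. *)
Lemma snk_double h w : 0 < h -> snk h w = snk (2 * h) w * snk (2 * h) (w - h).
Proof.
move=> h0; have h20 : 0 < 2 * h by rewrite mulr_gt0.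
have E N : tau_prod h N.*2 w = tau_prod (2 * h) N w * tau_prod (2 * h) N (w - h).
  elim: N => [|N IHN]; first by rewrite /tau_prod !big_ord0 mulr1.
  rewrite doubleS /tau_prod 2!big_ord_recr/= -/(tau_prod _ _ _) IHN.
  rewrite [X in _ = X * _]big_ord_recr [X in _ = _ * X]big_ord_recr/=.
  rewrite -/(tau_prod _ _ _) -/(tau_prod _ _ _).
  have -> : w - N.*2%:R * h = w - N%:R * (2 * h) by rewrite -muln2 natrM; ring.
  have -> : w + N.*2.+2%:R * h = w + N.+1%:R * (2 * h).
    by rewrite -doubleS -muln2 natrM; ring.
  have -> : w + N.*2.+1%:R * h = w - h + N.+1%:R * (2 * h).
    by rewrite -[in LHS]natr1 -muln2 natrM -natr1; ring.
  have -> : w - N.*2.+1%:R * h = w - h - N%:R * (2 * h).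
    by rewrite -natr1 -muln2 natrM; ring.
  ring.
have L1 : tau_prod h N.*2 w @[N --> \oo] --> snk h w.
  apply: (cvg_comp _ _ _ (@cvg_snk h w h0)) => A [n _ nA]; exists n => // k /= nk.
  by apply: nA => /=; rewrite (leq_trans nk)// -addnn leq_addl.
rewrite (funext E) in L1.
have L2 := cvgn_mul_eq (@cvg_snk _ w h20) (@cvg_snk _ (w - h) h20) erefl.
exact: (cvg_unique _ L1 L2).
Qed.

Lemma snk_addition h w v : 0 < h ->
  snk h (w + v) * snk h (w - v) * (1 - snk h w ^+ 2 * snk h v ^+ 2) =
  `|snk h w ^+ 2 - snk h v ^+ 2|.
Proof.
move=> h0; rewrite !real_normK ?num_real// -theta_quot_addition// normrM normrM.
rewrite (ger0_norm (x := 1 - _)) // subr_ge0.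
by apply: mulr_ile1; rewrite ?sqr_ge0// ltW// theta_quot_sqr_lt1.
Qed.

Lemma snk_max_le h N : 0 < h ->
  snk_max h <= \prod_(l < N) tau ((l%:R + 1 / 2) * h) ^+ 2.
Proof.
by move=> h0; rewrite /snk_max -snkN// -tau_prod_half snk_le_tau_prod.
Qed.

Lemma cvg_snk_max h : 0 < h ->
  \prod_(l < N) tau ((l%:R + 1 / 2) * h) ^+ 2 @[N --> \oo] --> snk_max h.
Proof.
move=> h0; rewrite /snk_max -snkN//.
have := @cvg_snk h (- (h / 2)) h0.
by rewrite (funext (tau_prod_half h)).
Qed.

Lemma snk_max_ge0 h : 0 <= snk_max h. Proof. exact: snk_ge0. Qed.

Lemma snk_max_lt1 h : 0 < h -> snk_max h < 1. Proof. exact: snk_lt1. Qed.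

(* Landen's transformation; the first alternative does not occur. *)
Lemma snk_max_landen h : 0 < h ->
  snk_max (2 * h) = 0 \/
  snk_max (2 * h) ^+ 2 * (1 + snk_max h ^+ 2) = 2 * snk_max h.
Proof.
move=> h0; have h20 : 0 < 2 * h by rewrite mulr_gt0.
have -> : snk_max (2 * h) = snk (2 * h) h by rewrite /snk_max; congr snk; field.
have E : snk_max h = snk (2 * h) (h / 2) ^+ 2.
  rewrite /snk_max snk_double//.
  have -> : h / 2 - h = - (h / 2) by field.
  by rewrite snkN// expr2.
(* For the step 2h, period and evenness fold 3h / 2 back to h / 2, so this instance relates only
   [snk (2 * h) h] and [snk (2 * h) (h / 2)]. *)
have := snk_addition h (h / 2) h20.
have -> : h + h / 2 = - (h / 2) + 2 * h by field.
have -> : h - h / 2 = h / 2 by field.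
rewrite snkD// snkN// -expr2 -E.
have := snk_max_lt1 h0; have := snk_max_ge0 h.
move: (snk_max h) (snk _ _) => q m {E} q0 q1.
have [mq|mq] := leP q (m ^+ 2).
  rewrite ger0_norm ?subr_ge0// => H; right; nra.
rewrite ltr0_norm ?subr_lt0// => H; left.
have : m ^+ 2 * (1 - q ^+ 2) = 0 by nra.
move/eqP; rewrite mulf_eq0 sqrf_eq0 => /orP[/eqP //|].
by move=> /eqP Hq; exfalso; nra.
Qed.

End Snk.

Section NodeProduct.
Context {R : realType}.
Implicit Types (h w v u d : R) (N k : nat).

(* The factors are indexed by residues modulo [2 k]: the shifts of [w] by
   [+- (j + 1/2) h + 2 k h Z], [j < k], are its shifts by [(Z + 1/2) h]. *)
Lemma snk_nodes_le h k w : 0 < h -> (0 < k)%N ->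
  \prod_(j < k) (snk (2 * (k%:R * h)) (w + (j%:R + 1 / 2) * h) *
                 snk (2 * (k%:R * h)) (w - (j%:R + 1 / 2) * h)) <= snk_max h.
Proof.
move=> h0 k0; set h' := 2 * (k%:R * h).
have h'0 : 0 < h' by rewrite !mulr_gt0// ltr0n.
pose g (l : int) := tau (w + (l%:~R + 1 / 2) * h).
have g01 l : 0 <= g l <= 1 by rewrite tau_ge0 tau_le1.
(* The integer nearest to [w / h]; recentring by it leaves |u| <= h / 2. *)
pose c := Num.floor (w / h + 1 / 2).
pose u := w - c%:~R * h.
have u_le : `|u| <= h / 2.
  have /andP[c1 c2] := floor_itv (w / h + 1 / 2).
  rewrite -/c intrD in c1 c2.
  have wE : w = w / h * h by rewrite divfK// gt_eqF.
  rewrite ler_norml /u; apply/andP; split; rewrite {1}wE.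
    have : (c%:~R - 1 / 2) * h <= w / h * h by rewrite ler_wpM2r// ?(ltW h0)//; lra.
    lra.
  have : w / h * h <= (c%:~R + 1 / 2) * h by rewrite ler_wpM2r// ?(ltW h0)//; lra.
  lra.
apply: (@cvgr_to_ge _ \oo _ _ _ _ _ (cvg_snk_max h0)).
apply: nearW => L.
pose F N := \prod_(j < k) (tau_prod h' N (w + (j%:R + 1 / 2) * h) *
                 tau_prod h' N (w - (j%:R + 1 / 2) * h)).
have [N NE] : exists N, N = (L + absz c).+1 by eexists.
apply: (@le_trans _ _ (F N)).
  apply: ler_prod => j _; rewrite mulr_ge0 ?snk_ge0//=.
  by apply: ler_pM; rewrite ?snk_ge0// snk_le_tau_prod.
(* The indices l of the shifts (l + 1/2) h of [w] that occur in [F N]; the node - (j + 1/2) h has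
   index - j - 1. *)
pose r : seq int := flatten [seq [:: j%:Z - (2 * k * i)%N%:Z; j%:Z + (2 * k * i.+1)%N%:Z;
   - j%:Z - 1 - (2 * k * i)%N%:Z; - j%:Z - 1 + (2 * k * i.+1)%N%:Z]
   | j <- iota 0 k, i <- iota 0 N].
have FE : F N = \prod_(l <- r) g l.
  rewrite /r big_flatten/= big_allpairs_dep/= /F.
  rewrite big_iota0; apply: eq_bigr => j _.
  rewrite big_iota0 /tau_prod -big_split/=.
  apply: eq_bigr => i _; rewrite !big_cons big_nil mulr1 mulrA.
  rewrite /g /h' !(intrD, intrN, intrB) -!pmulrn !natrM.
  by congr (_ * _ * (_ * _)); congr tau; field.
(* The 2L shifts that become +- (l + 1/2) h after recentring. Dropping all others enlarges the
   product, as [tau] is at most 1; [N] was chosen large enough for these to occur in [r]. *)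
pose s' : seq int := [seq l%:Z - c | l <- iota 0 L] ++ [seq - l%:Z - 1 - c | l <- iota 0 L].
apply: (@le_trans _ _ (\prod_(l <- s') g l)).
  rewrite FE; apply: ler_prod_sub => //.
    rewrite cat_uniq !map_inj_uniq ?iota_uniq//=; last 2 first.
    - by move=> a b; lia.
    - by move=> a b; lia.
    rewrite andbT; apply/hasPn => _ /mapP[l _ ->].
    by apply/negP => /mapP[l' _]; lia.
  move=> l ls; rewrite -[l]/(l : int) in ls *.
  have lL : (absz (l + c)%R <= L)%N.
    move: ls; rewrite mem_cat => /orP[] /mapP[l'];
      by rewrite mem_iota => /andP[_ l'L] ->; lia.
  (* Division of [l] by 2k with remainder [rho] in [-k, k): the sign of [rho] selects the sign of
     the node, and the sign of [t] the side of the window. *)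
  pose t := ((l + k%:Z) %/ (2 * k)%N%:Z)%Z.
  pose rho := l - t * (2 * k)%N%:Z.
  have k20 : ((2 * k)%N%:Z != 0)%R by lia.
  have rhoE : l + k%:Z = t * (2 * k)%N%:Z + (rho + k%:Z).
    by rewrite /rho; ring.
  have rho1 : 0 <= rho + k%:Z < (2 * k)%N%:Z.
    have -> : rho + k%:Z = ((l + k%:Z) %% (2 * k)%N%:Z)%Z.
      by rewrite /modz /rho -/t; ring.
    by rewrite modz_ge0// ltz_pmod// ltz_nat muln_gt0.
  have tN : (absz t < N)%N.
    have lB : (absz l <= L + absz c)%N by lia.
    have : (absz t <= absz l)%N.
      rewrite -lez_nat !abszE.
      move: rhoE rho1; rewrite PoszM => E /andP[? ?].
      have [t0|t0] := leP 1 t; first by rewrite !ger0_norm; nia.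
      have [t1|t1] := leP 0 t; first by have -> : t = 0 by lia.
      by rewrite !ltr0_norm; nia.
    by rewrite NE; lia.
  apply/flattenP.
  pose j := if 0 <= rho then absz rho else absz (rho + 1)%R.
  have jk : (j < k)%N by rewrite /j; case: ifP; lia.
  pose i := if t <= 0 then absz t else absz (t - 1)%R.
  have iN : (i < N)%N by rewrite /i; case: ifP; lia.
  eexists; first by apply/allpairsP; exists (j, i); rewrite !mem_iota /= jk iN.
  rewrite /= !inE.
  have -> : l = rho + t * (2 * k)%N%:Z by rewrite /rho; ring.
  rewrite /j /i !PoszM.
  case: ifP => rho0; case: ifP => t0.
  - apply/orP; left; apply/eqP; rewrite (_ : (absz t)%:Z = - t); last by lia.
    by rewrite (_ : (absz rho)%:Z = rho); [ring|lia].
  - apply/orP; right; apply/orP; left; apply/eqP.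
    rewrite (_ : (absz (t - 1)%R).+1%:Z = t); last by lia.
    by rewrite (_ : (absz rho)%:Z = rho); [ring|lia].
  - apply/orP; right; apply/orP; right; apply/orP; left; apply/eqP.
    rewrite (_ : (absz t)%:Z = - t); last by lia.
    by rewrite (_ : (absz (rho + 1)%R)%:Z = - (rho + 1)); [ring|lia].
  - apply/orP; right; apply/orP; right; apply/orP; right; apply/eqP.
    rewrite (_ : (absz (t - 1)%R).+1%:Z = t); last by lia.
    by rewrite (_ : (absz (rho + 1)%R)%:Z = - (rho + 1)); [ring|lia].
rewrite big_cat/= !big_map.
rewrite !big_iota0 -big_split/=.
apply: ler_prod => l _; rewrite mulr_ge0 ?tau_ge0//=.
have -> : g (l%:Z - c) = tau (u + (l%:R + 1 / 2) * h).
  by rewrite /g /u intrB -pmulrn; congr tau; ring.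
have -> : g (- l%:Z - 1 - c) = tau (u - (l%:R + 1 / 2) * h).
  by rewrite /g /u !intrB intrN -pmulrn; congr tau; field.
apply: tau_pair_le; apply: (le_trans u_le).
have : 0 <= l%:R * h by rewrite mulr_ge0// ltW.
by lra.
Qed.
End NodeProduct.

(** * Nome estimates *)

Section ElementaryBounds.
Context {R : realType}.
Implicit Types (x y a b : R).

Lemma derive_ge0_le (f df : R -> R) a b : a <= b ->
  (forall x, a <= x <= b -> is_derive x 1 f (df x)) ->
  (forall x, a <= x <= b -> 0 <= df x) -> f a <= f b.
Proof.
move=> ab fdf df0.
have [x|c|] := @MVT_segment R f df a b ab.
- by rewrite in_itv/= => /andP[ax xb]; apply: fdf; rewrite !ltW.
- apply: derivable_within_continuous => x; rewrite in_itv/= => xab.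
  by have := fdf x xab => -[].
move=> c; rewrite in_itv/= => cab E.
by rewrite -subr_ge0 E mulr_ge0 ?subr_ge0// df0.
Qed.

Lemma mul_cos_le_sin x : 0 <= x <= pi / 2 -> x * cos x <= sin x.
Proof.
move=> /andP[x0 xpi]; rewrite -subr_ge0.
pose f := (@sin R) - (@id R * @cos R).
have -> : sin x - x * cos x = f x by [].
have -> : 0 = f 0 by rewrite /f !fctE sin0 mul0r subrr.
apply: (@derive_ge0_le f (fun y => y * sin y)) => // y /andP[y0 yx].
  apply: is_derive_eq.
  by rewrite /GRing.scale/=; ring.
rewrite mulr_ge0// sin_ge0_pi// y0 /=; have := @pi_ge0 R; lra.
Qed.

Lemma ln_artanh_ge M y : 0 <= y < 1 ->
  2 * \sum_(i < M) y ^+ i.*2.+1 / i.*2.+1%:R <= ln (1 + y) - ln (1 - y).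
Proof.
move=> /andP[y0 y1]; rewrite -subr_ge0.
pose P M (z : R) := \sum_(i < M) z ^+ i.*2.+1 / i.*2.+1%:R.
have dP (z : R) : is_derive z 1 (P M) (\sum_(i < M) z ^+ i.*2).
  elim: M => [|M IHM].
    rewrite big_ord0 (_ : P 0%N = cst 0) ?funeqE//; first exact: is_derive_cst.
    by move=> t; rewrite /P big_ord0.
  rewrite big_ord_recr/= (_ : P M.+1 = P M + (M.*2.+1%:R^-1 *: (@id R ^+ M.*2.+1))).
    have := is_deriveD IHM (is_deriveZ M.*2.+1%:R^-1
      (is_deriveX M.*2.+1 (is_derive_id z (1 : R)))).
    by rewrite /GRing.scale/= mulr1 mulrA mulVf ?mul1r// pnatr_eq0.
  rewrite funeqE => t; rewrite /P big_ord_recr/= !fctE; congr (_ + _).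
  by rewrite mulrC.
pose f z := ln (1 + z) - ln (1 - z) - 2 * P M z.
have -> : ln (1 + y) - ln (1 - y) - 2 * (\sum_(i < M) y ^+ i.*2.+1 / i.*2.+1%:R) = f y by [].
have -> : 0 = f 0.
  rewrite /f addr0 subr0 subrr /P big1 ?mulr0 ?subrr// => i _.
  by rewrite expr0n mul0r.
apply: (@derive_ge0_le f (fun z => (1 + z)^-1 + (1 - z)^-1 - 2 * \sum_(i < M) z ^+ i.*2)) => // z /andP[z0 zy].
  have zpos : 0 < 1 + z by lra.
  have zneg : 0 < 1 - z by lra.
  have dln (c : R) : 0 < 1 + c * z ->
      is_derive z 1 (fun t => ln (1 + c * t)) ((1 + c * z)^-1 * c).
    move=> cz; apply: (@is_derive1_comp R (@ln R) (fun t => 1 + c * t)).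
      exact: is_derive1_ln.
    have := is_deriveD (is_derive_cst (1 : R) z 1) (is_deriveZ c (is_derive_id z (1 : R))).
    by rewrite add0r /GRing.scale/= mulr1.
  have d1 : is_derive z 1 (fun t => ln (1 + t)) (1 + z)^-1.
    rewrite -[X in is_derive _ _ _ X]mulr1 -[z in X in is_derive _ _ _ X]mul1r.
    have -> : (fun t : R => ln (1 + t)) = (fun t => ln (1 + 1 * t)).
      by rewrite funeqE => t; rewrite mul1r.
    by apply: dln; rewrite mul1r.
  have d2 : is_derive z 1 (fun t => ln (1 - t)) (- (1 - z)^-1).
    rewrite -[X in is_derive _ _ _ X]mulrN1 -[- z]mulN1r.
    have -> : (fun t : R => ln (1 - t)) = (fun t => ln (1 + -1 * t)).
      by rewrite funeqE => t; rewrite mulN1r.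
    by apply: dln; rewrite mulN1r.
  have -> : f = ((fun t => ln (1 + t)) - (fun t => ln (1 - t))) - (2 : R) *: P M by [].
  have := is_deriveB (is_deriveB d1 d2) (is_deriveZ 2 (dP z)).
  by rewrite opprK.
have z1 : z < 1 by lra.
have E : (1 - z ^+ 2) * \sum_(i < M) z ^+ i.*2 = 1 - z ^+ M.*2.
  rewrite -[in RHS]mul2n exprM -[RHS]mul_sub_geometric; congr (_ * _).
  by apply: eq_bigr => i _; rewrite -mul2n exprM.
have z20 : 0 < 1 - z ^+ 2 by rewrite subr_gt0 expr_lt1.
have -> : (1 + z)^-1 + (1 - z)^-1 - 2 * \sum_(i < M) z ^+ i.*2 =
   2 * z ^+ M.*2 / (1 - z ^+ 2).
  have -> : \sum_(i < M) z ^+ i.*2 = (1 - z ^+ M.*2) / (1 - z ^+ 2).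
    by rewrite -E mulrC mulKf// gt_eqF.
  by field; rewrite !gt_eqF; lra.
by rewrite divr_ge0 ?mulr_ge0 ?exprn_ge0// ltW.
Qed.

End ElementaryBounds.

Section NomeBounds.
Context {R : realType}.
Implicit Types (x y h w : R) (m M N : nat).

Lemma sum_fold (F : nat -> R) N :
  \sum_(j < N.*2) F j = \sum_(j < N) (F j + F (N.*2.-1 - j)%N).
Proof.
rewrite -addnn big_split_ord/= big_split/=; congr (_ + _).
rewrite (reindex_inj rev_ord_inj)/=; apply: eq_bigr => i _; congr F.
by have := ltn_ord i; lia.
Qed.

(** Folding the sum pairs x with pi / 2 - x, and 1 / sin^2 x + 1 / cos^2 x = 4 / sin^2 (2x). *)
Lemma sum_sin_inv_sqr m :
  \sum_(j < 2 ^ m) (sin (j.*2.+1%:R * pi / 2 ^+ m.+2) ^- 2) = 2 * 4 ^+ m :> R.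
Proof.
elim: m => [|m IHm].
  rewrite big_ord1 mul1r expr0 mulr1.
  have -> : pi / 2 ^+ 2 = pi / 4 :> R by congr (_ / _); ring.
  have c0 : cos (pi / 4) != 0 :> R.
    rewrite gt_eqF// cos_gt0_pihalf//; have := @pi_gt0 R; lra.
  have := @tan_piquarter R; rewrite /tan => /(canRL (divfK c0)); rewrite mul1r => sc.
  have := cos2Dsin2 (pi / 4 : R); rewrite -sc => H.
  have -> : sin (pi / 4) ^+ 2 = 2^-1 :> R by lra.
  by rewrite invrK.
rewrite expnS mul2n.
rewrite (sum_fold (fun j => sin (j.*2.+1%:R * pi / 2 ^+ m.+3) ^- 2)).
rewrite [4 ^+ m.+1]exprS mulrCA -IHm mulr_sumr.
apply: eq_bigr => j _.
set x := j.*2.+1%:R * pi / 2 ^+ m.+3 : R.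
have jN : (j < 2 ^ m)%N by exact: ltn_ord.
have p0 : 0 < 2 ^+ m.+3 :> R by rewrite exprn_gt0.
have pe : 2 ^+ m.+3 = 8 * (2 ^ m)%N%:R :> R by rewrite natrX !exprS; ring.
have -> : (((2 ^ m).*2.-1 - j)%N.*2.+1%:R * pi / 2 ^+ m.+3) = pi / 2 - x.
  have -> : (((2 ^ m).*2.-1 - j)%N.*2.+1)%:R = 4 * (2 ^ m)%N%:R - j.*2.+1%:R :> R.
    have -> : (((2 ^ m).*2.-1 - j)%N.*2.+1 = 4 * 2 ^ m - j.*2.+1)%N by lia.
    by rewrite natrB ?natrM//; lia.
  rewrite /x pe; field.
  by rewrite pnatr_eq0 -lt0n expn_gt0.
have -> : sin (pi / 2 - x) = cos x by rewrite addrC sinDpihalf cosN.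
have -> : j.*2.+1%:R * pi / 2 ^+ m.+2 = x *+ 2.
  by rewrite /x [2 ^+ m.+3]exprS -mulr_natr; field; rewrite expf_neq0.
have x0 : 0 < x by rewrite !mulr_gt0 ?invr_gt0 ?pi_gt0.
have xpi : x < pi / 2.
  rewrite /x pe ltr_pdivrMr ?mulr_gt0 ?ltr0n ?expn_gt0//.
  rewrite (_ : pi / 2 * _ = pi * (4 * (2 ^ m)%N%:R)); last by field.
  rewrite mulrC ltr_pM2l ?pi_gt0// -natrM ltr_nat; lia.
have s0 : sin x != 0 by rewrite gt_eqF// sin_gt0_pihalf// x0.
have c0 : cos x != 0 by rewrite gt_eqF// cos_gt0_pihalf// xpi andbT; lra.
rewrite sin_mulr2n -mulr_natr.
have -> : (sin x) ^- 2 + (cos x) ^- 2 =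
  (cos x ^+ 2 + sin x ^+ 2) / (sin x ^+ 2 * cos x ^+ 2).
  by field; rewrite s0 c0.
by rewrite cos2Dsin2; field; rewrite s0 c0.
Qed.

(** Cauchy's comparison for the sum pi^2 / 8 of the inverse odd squares: x cos x <= sin x gives 1 /
    sin^2 x <= 1 + 1 / x^2, which is summed against the exact finite sum. *)
Lemma sum_odd_inv_sqr_ge m :
  pi ^+ 2 / 8 - pi ^+ 2 / 16 * (1 / 2) ^+ m <=
  \sum_(i < 2 ^ m) (i.*2.+1%:R : R) ^- 2.
Proof.
have pi0 := @pi_gt0 R.
have key (i : 'I_(2 ^ m)) : sin (i.*2.+1%:R * pi / 2 ^+ m.+2) ^- 2 <=
    1 + 16 * 4 ^+ m / pi ^+ 2 * (i.*2.+1%:R : R) ^- 2.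
  set x := i.*2.+1%:R * pi / 2 ^+ m.+2 : R.
  have x0 : 0 < x by rewrite !mulr_gt0 ?invr_gt0 ?exprn_gt0 ?pi_gt0.
  have pe : 2 ^+ m.+2 = 4 * (2 ^ m)%N%:R :> R by rewrite natrX !exprS; ring.
  have xpi : x < pi / 2.
    rewrite /x pe ltr_pdivrMr ?mulr_gt0 ?ltr0n ?expn_gt0//.
    rewrite (_ : pi / 2 * _ = pi * (2 * (2 ^ m)%N%:R)); last by field.
    by rewrite mulrC ltr_pM2l ?pi_gt0// -natrM ltr_nat; have := ltn_ord i; lia.
  have s0 : 0 < sin x by rewrite sin_gt0_pihalf// x0.
  have c0 : 0 < cos x by rewrite cos_gt0_pihalf// xpi andbT; lra.
  have sc : x * cos x <= sin x by apply: mul_cos_le_sin; rewrite !ltW.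
  have -> : 16 * 4 ^+ m / pi ^+ 2 * (i.*2.+1%:R : R) ^- 2 = x ^- 2.
    have -> : 16 * 4 ^+ m = (2 ^+ m.+2) ^+ 2 :> R.
      by rewrite -exprM mulnC exprM (_ : 2 ^+ 2 = 4) ?[in RHS]exprS; ring.
    have gen (p a b : R) : p != 0 -> a != 0 -> b != 0 ->
      b ^+ 2 / p ^+ 2 * a ^- 2 = (a * p / b) ^- 2.
      by move=> p1 a1 b1; field; rewrite p1 a1 b1.
    by rewrite /x gen ?expf_neq0 ?pnatr_eq0// gt_eqF.
  have -> : 1 + x ^- 2 = (x ^+ 2 + 1) / x ^+ 2 by field; rewrite gt_eqF.
  rewrite -div1r ler_pdivrMr ?exprn_gt0// mulrAC ler_pdivlMr ?exprn_gt0// mul1r.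
  have := cos2Dsin2 x => H.
  have : (x * cos x) ^+ 2 <= sin x ^+ 2.
    by rewrite ler_pXn2r// nnegrE ?ltW// mulr_gt0.
  by nra.
have := sum_sin_inv_sqr m.
have : \sum_(j < 2 ^ m) (sin (j.*2.+1%:R * pi / 2 ^+ m.+2) ^- 2) <=
  \sum_(j < 2 ^ m) (1 + 16 * 4 ^+ m / pi ^+ 2 * (j.*2.+1%:R : R) ^- 2).
  by apply: ler_sum => i _; exact: key.
rewrite big_split/= -mulr_sumr sumr_const card_ord => H E; move: H; rewrite E.
set S := \sum_(i < _) _ => H.
have e4 : 4 ^+ m = 2 ^+ m * 2 ^+ m :> R by rewrite -exprMn; congr (_ ^+ _); ring.
have p2 : 0 < 2 ^+ m :> R by rewrite exprn_gt0.
rewrite expr_div_n expr1n.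
rewrite -(ler_pM2l (x := 16 * 4 ^+ m / pi ^+ 2)); last first.
  by rewrite !mulr_gt0 ?invr_gt0 ?exprn_gt0.
have -> : 16 * 4 ^+ m / pi ^+ 2 * (pi ^+ 2 / 8 - pi ^+ 2 / 16 * (1 / 2 ^+ m)) =
  2 * 4 ^+ m - 2 ^+ m :> R.
  rewrite e4; have := gt_eqF (exprn_gt0 2 pi0); move: (pi ^+ 2) => p pi_neq0.
  by field; rewrite pi_neq0 (gt_eqF p2).
by move: H; rewrite natrX lerBlDl.
Qed.

(** [tau d] is exp (- 2 artanh (exp (- d))), and the artanh series is cut after M terms. *)
Lemma tau_le_expR M (d : R) : 0 < d ->
  tau d <= expR (- (2 * \sum_(i < M) expR (- (i.*2.+1%:R * d)) / i.*2.+1%:R)).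
Proof.
move=> d0; set y := expR (- d).
have y0 : 0 < y := expR_gt0 _.
have y1 : y < 1 by rewrite expR_lt1 oppr_lt0.
have -> : tau d = expR (- (ln (1 + y) - ln (1 - y))).
  rewrite -tauN /tau -/y opprB expRB !lnK ?posrE; try lra.
  by rewrite ger0_norm ?subr_ge0 ?ltW.
rewrite ler_expR lerN2.
have := @ln_artanh_ge R M y; rewrite (ltW y0) y1 => /(_ isT).
apply: le_trans; rewrite le_eqVlt; apply/orP; left; apply/eqP; congr (_ * _).
by apply: eq_bigr => i _; rewrite /y -expRM_natl mulrN.
Qed.

(** Summed over the lattice, each artanh term gives a geometric series in l, bounded below by means
    of 1 - exp (- c h) <= c h. M stays finite so that only finite sums are exchanged. *)
Lemma snk_max_le_expR h M : 0 < h ->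
  snk_max h <=
  expR (- (4 / h * \sum_(i < M) expR (- (i.*2.+1%:R * h / 2)) / i.*2.+1%:R ^+ 2)).
Proof.
move=> h0.
pose G L (i : nat) := expR (- (i.*2.+1%:R * h / 2)) / i.*2.+1%:R ^+ 2 *
    (1 - expR (- (i.*2.+1%:R * h)) ^+ L) : R.
have cG : expR (- (4 / h * \sum_(i < M) G L i)) @[L --> \oo] -->
  expR (- (4 / h * \sum_(i < M) expR (- (i.*2.+1%:R * h / 2)) / i.*2.+1%:R ^+ 2)).
  apply: continuous_cvg; first exact: continuous_expR.
  apply: cvgN; apply: cvgMr.
  apply: cvg_big => [|i _]; first exact: add_continuous.
  apply: (@cvgn_mul_eq _ _ _ (expR (- (i.*2.+1%:R * h / 2)) / i.*2.+1%:R ^+ 2) (1 - 0)).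
  - exact: cvg_cst.
  - by apply: cvgB; [exact: cvg_cst|apply: cvg_expRN_pow; rewrite mulr_gt0].
  - by rewrite subr0 mulr1.
apply: (cvgr_to_ge cG); apply: nearW => L.
apply: (le_trans (snk_max_le L h0)).
apply: (@le_trans _ _ (\prod_(l < L) expR (- (4 *
   \sum_(i < M) expR (- (i.*2.+1%:R * ((l%:R + 1 / 2) * h))) / i.*2.+1%:R)))).
  apply: ler_prod => l _; rewrite exprn_ge0 ?tau_ge0//=.
  have d0 : 0 < (l%:R + 1 / 2) * h by rewrite mulr_gt0// ltr_wpDl.
  have H := tau_le_expR M d0.
  apply: (le_trans (y := expR (- (2 * \sum_(i < M) expR (- (i.*2.+1%:R * ((l%:R + 1 / 2) * h))) / i.*2.+1%:R)) ^+ 2)).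
    by rewrite ler_pXn2r// nnegrE ?tau_ge0 ?expR_ge0.
  by rewrite expr2 -expRD ler_expR; lra.
rewrite -expR_sum ler_expR sumrN lerN2 -mulr_sumr exchange_big/=.
rewrite -[4 / h]mulr1 -!mulrA ler_pM2l// mul1r mulr_sumr; apply: ler_sum => i _.
set c := i.*2.+1%:R : R; have c0 : 0 < c by rewrite ltr0n.
rewrite -mulr_suml.
set q := expR (- (c * h)).
have ch0 : 0 < c * h by rewrite mulr_gt0.
have q0 : 0 < q := expR_gt0 _.
have q1 : q < 1 by rewrite expR_lt1 oppr_lt0.
have -> : \sum_(l < L) expR (- (c * ((l%:R + 1 / 2) * h))) =
   expR (- (c * h / 2)) * \sum_(l < L) q ^+ l.
  rewrite mulr_sumr; apply: eq_bigr => l _; rewrite /q -expRM_natl -expRD.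
  by congr expR; field.
have E := mul_sub_geometric q L.
have q2 : 1 - q <= c * h by have := expR_ge1Dx (- (c * h)); rewrite -/q; lra.
have S0 : 0 <= \sum_(l < L) q ^+ l by apply: sumr_ge0 => l _; rewrite exprn_ge0// ltW.
rewrite /G -/c -/q -E.
rewrite (_ : h^-1 * _ = expR (- (c * h / 2)) * (((1 - q) * \sum_(l < L) q ^+ l) / (c * h)) / c); last first.
  by field; rewrite !gt_eqF.
rewrite ler_pM2r ?invr_gt0// ler_pM2l ?expR_gt0//.
by rewrite ler_pdivrMr// mulrC ler_wpM2l.
Qed.

Lemma snk_max_sqr_le h : 0 < h -> snk_max (2 * h) ^+ 2 <= 2 * snk_max h.
Proof.
move=> h0; have T0 := snk_max_ge0 h.
have [->|<-] := snk_max_landen h0; first by rewrite expr0n mulr_ge0.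
by rewrite ler_peMr ?sqr_ge0// lerDl sqr_ge0.
Qed.

(* The bound [sqrt k <= 2 q^(1/4)]: by the Landen step, halving [h] does not
   decrease [h * ln (snk_max h / 2)], whose limit at 0 is
   [- 4 * \sum_i (2 i + 1)^-2 = - pi^2 / 2]. *)
Lemma snk_max_upper h : 0 < h -> snk_max h <= 2 * expR (- (pi ^+ 2 / (2 * h))).
Proof.
move=> h0.
pose c m : R := (1 / 2) ^+ m.
have c_gt0 m : 0 < c m by rewrite exprn_gt0// divr_gt0.
have cc : c m @[m --> \oo] --> (0 : R).
  by apply: cvg_expr; rewrite ger0_norm; lra.
(* Written as (x / 2)^2 <= y / 2, the Landen inequality iterates without accumulating constants;
   this is the origin of the factor 2. *)
have pw m : (snk_max h / 2) ^+ (2 ^ m) <= snk_max (h * c m) / 2.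
  elim: m => [|m IHm]; first by rewrite expn0 expr1 /c expr0 mulr1.
  rewrite expnSr exprM.
  have hc : 0 < h * c m.+1 by rewrite mulr_gt0.
  have := snk_max_sqr_le hc.
  have -> : 2 * (h * c m.+1) = h * c m by rewrite /c exprS; field.
  have := snk_max_ge0 (h * c m.+1) => ? H.
  apply: (@le_trans _ _ ((snk_max (h * c m) / 2) ^+ 2)).
    by rewrite ler_pXn2r// nnegrE ?exprn_ge0 ?divr_ge0// ?snk_max_ge0.
  by rewrite expr_div_n; lra.
pose B M (x : R) := \sum_(i < M) expR (- (i.*2.+1%:R * x / 2)) / i.*2.+1%:R ^+ 2.
have step1 M m : snk_max h / 2 <= expR (- (4 / h * B M (h * c m))).
  have hc : 0 < h * c m by rewrite mulr_gt0.
  have := pw m; have := snk_max_le_expR M hc; rewrite -/(B M _) => H1 H2.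
  rewrite -(@ler_pXn2r _ (2 ^ m)) ?expn_gt0// ?nnegrE ?expR_ge0 ?divr_ge0 ?snk_max_ge0//.
  apply: (le_trans H2); rewrite -expRM_natl.
  have -> : (2 ^ m)%:R * - (4 / h * B M (h * c m)) = - (4 / (h * c m) * B M (h * c m)).
    rewrite natrX /c expr_div_n expr1n; field.
    by rewrite (gt_eqF h0) expf_neq0.
  apply: le_trans H1; rewrite ler_pdivrMr// ler_peMr ?snk_max_ge0//.
  by lra.
(* The step tends to 0 with M fixed; M = 2^m goes to infinity only afterwards. *)
have step2 M : snk_max h / 2 <= expR (- (4 / h * \sum_(i < M) (i.*2.+1%:R : R) ^- 2)).
  have cB : expR (- (4 / h * B M (h * c m))) @[m --> \oo] -->
      expR (- (4 / h * \sum_(i < M) (i.*2.+1%:R : R) ^- 2)).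
    apply: continuous_cvg; first exact: continuous_expR.
    apply: cvgN; apply: cvgMr; apply: cvg_big => [|i _]; first exact: add_continuous.
    apply: (@cvgn_mul_eq _ _ _ (expR (- (i.*2.+1%:R * (h * 0) / 2))) (i.*2.+1%:R ^- 2)).
    - apply: continuous_cvg; first exact: continuous_expR.
      by apply: cvgN; apply: cvgMl; apply: cvgMr; apply: cvgMr.
    - exact: cvg_cst.
    - by rewrite !(mulr0, mul0r) oppr0 expR0 mul1r.
  by apply: (cvgr_to_ge cB); exact: nearW.
rewrite mulrC -ler_pdivrMr//.
have cB : expR (- (4 / h * (pi ^+ 2 / 8 - pi ^+ 2 / 16 * c m))) @[m --> \oo] -->
    expR (- (4 / h * (pi ^+ 2 / 8 - pi ^+ 2 / 16 * 0))).
  apply: continuous_cvg; first exact: continuous_expR.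
  apply: cvgN; apply: cvgMr; apply: cvgB; first exact: cvg_cst.
  exact: cvgMr.
have -> : - (pi ^+ 2 / (2 * h)) = - (4 / h * (pi ^+ 2 / 8 - pi ^+ 2 / 16 * 0)).
  by field; rewrite gt_eqF.
apply: (cvgr_to_ge cB); apply: nearW => m; apply: (le_trans (step2 (2 ^ m)%N)).
rewrite ler_expR lerN2 ler_wpM2l ?divr_ge0 ?(ltW h0)//.
exact: sum_odd_inv_sqr_ge.
Qed.

End NomeBounds.

(** * Zolotarev's rational function *)

Lemma cvgnX {R : realType} (f : nat -> R) (a : R) n :
  f N @[N --> \oo] --> a -> f N ^+ n @[N --> \oo] --> a ^+ n.
Proof.
move=> fa; elim: n => [|n IHn].
  rewrite expr0 (_ : (fun N => _) = cst 1); first exact: cvg_cst.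
  by apply/funext => N; rewrite expr0.
rewrite exprS (_ : (fun N => _) = (fun N => f N * f N ^+ n)).
  exact: cvgn_mul_eq fa IHn erefl.
by apply/funext => N; rewrite exprS.
Qed.

Section Zolotarev.
Context {R : realType}.
Implicit Types (x y h w L : R) (m M N k : nat).

(** By Bernoulli's inequality. It removes a constant factor from a bound known for all the powers
    2^m. *)
Lemma le1_of_expr_bounded x (C : R) : 0 <= x ->
  (forall m, x ^+ (2 ^ m) <= C) -> x <= 1.
Proof.
move=> x0 H; rewrite leNgt; apply/negP => x1.
have bern n : 1 + n%:R * (x - 1) <= x ^+ n.
  elim: n => [|n IHn]; first by rewrite mul0r addr0 expr0.
  rewrite exprS; apply: (@le_trans _ _ (x * (1 + n%:R * (x - 1)))).
    rewrite -natr1; have : 0 <= n%:R * (x - 1) ^+ 2 by rewrite mulr_ge0// sqr_ge0.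
    nra.
  by rewrite ler_pM2l//; lra.
have C0 : 0 <= C by apply: le_trans (H 0%N); rewrite exprn_ge0.
have [m Hm] : exists m : nat, C / (x - 1) < m%:R.
  by exists (Num.bound (C / (x - 1))); apply: archi_boundP; rewrite divr_ge0// subr_ge0 ltW.
have := H m; have := bern (2 ^ m)%N; rewrite ltr_pdivrMr ?subr_gt0// in Hm.
have : m%:R * (x - 1) <= (2 ^ m)%:R * (x - 1).
  by rewrite ler_wpM2r ?subr_ge0 ?(ltW x1)// ler_nat ltnW// ltn_expl.
by lra.
Qed.

Lemma prod_ge_one_sub_sum (I : Type) (r : seq I) (a : I -> R) :
  (forall i, 0 <= a i <= 1) -> 1 - \sum_(i <- r) (1 - a i) <= \prod_(i <- r) a i.
Proof.
move=> a01; elim: r => [|i r IHr]; first by rewrite !big_nil subr0.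
rewrite !big_cons; have /andP[a0 a1] := a01 i.
have P1 : \prod_(j <- r) a j <= 1 by apply: prodr_ile1 => j _; exact: a01.
by nra.
Qed.

(** The factors are tau^8, and 1 - t^8 <= 8 (1 - t) <= 16 exp (- d) for t = tau d. The constant 16
    is thus already right; only the geometric factor 1 / (1 - exp (- h)) has to be removed. *)
Lemma snk_max_lower_weak h : 0 < h ->
  1 - snk_max h ^+ 4 <= 16 * (expR (- (h / 2)) / (1 - expR (- h))).
Proof.
move=> h0; set q := expR (- h).
have q0 : 0 < q := expR_gt0 _.
have q1 : q < 1 by rewrite expR_lt1 oppr_lt0.
rewrite lerBlDr -lerBlDl.
have cT : (\prod_(l < N) tau ((l%:R + 1 / 2) * h) ^+ 2) ^+ 4 @[N --> \oo] --> snk_max h ^+ 4.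
  exact: cvgnX (cvg_snk_max h0).
apply: (cvgr_to_ge cT); apply: nearW => N.
rewrite -prodrXl.
apply: le_trans (prod_ge_one_sub_sum _ _); last first.
  by move=> l; rewrite !exprn_ge0 ?tau_ge0//= !exprn_ile1 ?exprn_ge0 ?tau_ge0 ?tau_le1.
rewrite lerB// (@le_trans _ _ (\sum_(l < N) 16 * (expR (- (h / 2)) * q ^+ l)))//.
  apply: ler_sum => l _.
  set d := (l%:R + 1 / 2) * h.
  have -> : expR (- (h / 2)) * q ^+ l = expR (- d).
    by rewrite /q -expRM_natl -expRD; congr expR; rewrite /d; field.
  have d0 : 0 < d by rewrite mulr_gt0// ltr_wpDl.
  set y := expR (- d).
  have y0 : 0 < y := expR_gt0 _.
  have y1 : y < 1 by rewrite expR_lt1 oppr_lt0.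
  have tE : tau d = (1 - y) / (1 + y).
    by rewrite -tauN /tau -/y ger0_norm// subr_ge0 ltW.
  have t0 := tau_ge0 d; have t1 := tau_le1 d.
  have t2 : 1 - 2 * y <= tau d.
    by rewrite tE ler_pdivlMr ?addr_gt0//; nra.
  move: (tau d) t0 t1 t2 => t t0 t1 t2.
  have b2 (z : R) : 0 <= z <= 1 -> 1 - z ^+ 2 <= 2 * (1 - z) by nra.
  have t01 : 0 <= t <= 1 by rewrite t0.
  have t201 : 0 <= t ^+ 2 <= 1 by rewrite exprn_ge0 ?exprn_ile1.
  have t401 : 0 <= (t ^+ 2) ^+ 2 <= 1 by rewrite !exprn_ge0 ?exprn_ile1 ?exprn_ge0.
  have := b2 _ t01; have := b2 _ t201; have := b2 _ t401.
  by rewrite -!exprM /=; lra.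
rewrite -mulr_sumr ler_pM2l// -mulr_sumr ler_pM2l ?expR_gt0//.
by rewrite geometric_le// q0.
Qed.

(* The bound [k'^2 <= 16 q'] for [k'^2 = 1 - snk_max h ^+ 4]: the Landen step
   gives [(u h)^2 <= u (2 h)] for [u = k'^2 / 16], so the weak bound at [2^m h]
   sharpens as [m] grows. *)
Lemma snk_max_lower h : 0 < h -> 1 - snk_max h ^+ 4 <= 16 * expR (- (h / 2)).
Proof.
move=> h0.
pose u x := (1 - snk_max x ^+ 4) / 16.
have T01 x : 0 < x -> 0 <= snk_max x ^+ 4 <= 1.
  move=> x0; rewrite exprn_ge0 ?snk_max_ge0//= exprn_ile1 ?snk_max_ge0//.
  by rewrite ltW// snk_max_lt1.
have u0 x : 0 < x -> 0 <= u x.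
  by move=> x0; rewrite divr_ge0// subr_ge0; have /andP[] := T01 _ x0.
have uD x : 0 < x -> u x ^+ 2 <= u (2 * x).
  move=> x0; rewrite /u; have := T01 _ x0 => /andP[]; have := snk_max_ge0 x.
  have := snk_max_landen x0; move: (snk_max x) (snk_max _) => T S.
  case=> [->|E] T0 T40 T41; first by rewrite expr0n/=; move: (T ^+ 4) T40 T41 => z ? ?; nra.
  have A0 : 0 < 1 + T ^+ 2 by rewrite ltr_pwDl ?sqr_ge0.
  have S2 : S ^+ 2 = 2 * T / (1 + T ^+ 2) by rewrite -E mulfK// gt_eqF.
  have -> : S ^+ 4 = (2 * T / (1 + T ^+ 2)) ^+ 2 by rewrite -S2 -exprM.
  have -> : 1 - (2 * T / (1 + T ^+ 2)) ^+ 2 = ((1 - T ^+ 4) / (1 + T ^+ 2) ^+ 2) ^+ 2.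
    by field; rewrite gt_eqF.
  have T21 : T ^+ 2 <= 1 by rewrite -(@ler_pXn2r _ 2) ?nnegrE ?sqr_ge0// expr1n -exprM.
  (* T^2 <= 1 gives (1 + T^2)^2 <= 4, which is why 16 = 4^2 is the right normalisation of [u]. *)
  have -> : ((1 - T ^+ 4) / 16) ^+ 2 = ((1 - T ^+ 4) / 4) ^+ 2 / 16 by field.
  rewrite ler_pM2r// ler_pXn2r ?nnegrE ?divr_ge0 ?sqr_ge0 ?subr_ge0//.
  rewrite ler_wpM2l ?subr_ge0// lef_pV2 ?posrE ?exprn_gt0//.
  by nra.
have uX m : u h ^+ (2 ^ m) <= u (2 ^+ m * h).
  elim: m => [|m IHm]; first by rewrite expn0 expr1 mul1r.
  have p0 : 0 < 2 ^+ m * h by rewrite mulr_gt0 ?exprn_gt0.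
  rewrite expnSr exprM [2 ^+ m.+1]exprS -mulrA; apply: le_trans (uD _ p0).
  by rewrite ler_pXn2r// nnegrE ?exprn_ge0 ?u0.
suff : u h * expR (h / 2) <= 1.
  rewrite -ler_pdivlMr ?expR_gt0// div1r -expRN /u ler_pdivrMr//.
  by rewrite mulrC.
apply: (@le1_of_expr_bounded _ (1 - expR (- h))^-1).
  by rewrite mulr_ge0 ?u0 ?expR_ge0.
move=> m; rewrite exprMn -expRM_natl.
have p0 : 0 < 2 ^+ m * h by rewrite mulr_gt0 ?exprn_gt0.
have q1 : expR (- h) < 1 by rewrite expR_lt1 oppr_lt0.
have hm : h <= 2 ^+ m * h by rewrite ler_peMl ?(ltW h0)// exprn_ege1// ler1n.
have qm : expR (- (2 ^+ m * h)) <= expR (- h) by rewrite ler_expR lerN2.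
have := snk_max_lower_weak p0 => H.
apply: (@le_trans _ _ (expR (- (2 ^+ m * h / 2)) / (1 - expR (- (2 ^+ m * h))) *
   expR ((2 ^ m)%:R * (h / 2)))).
  rewrite ler_pM2r ?expR_gt0//; apply: (le_trans (uX m)).
  by rewrite /u ler_pdivrMr// [leRHS]mulrC.
rewrite mulrAC -expRD natrX mulrA addNr expR0 mul1r.
by rewrite lef_pV2 ?posrE ?subr_gt0 ?(le_lt_trans qm)// lerD2l lerN2.
Qed.

(** The addition theorem makes snk^2 Lipschitz with constant 1, as snk (w - v) <= tau (w - v) <= |w
    - v|. *)
Lemma snk_sqr_continuous h : 0 < h -> continuous (fun w => snk h w ^+ 2 : R).
Proof.
move=> h0 w; apply/cvgrPdist_le => e e0; near=> v.
have lip : `|snk h w ^+ 2 - snk h v ^+ 2| <= `|w - v|.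
  rewrite -snk_addition//.
  have s1 u : snk h u <= 1 by rewrite ltW// snk_lt1.
  have s2 u : 0 <= snk h u ^+ 2 <= 1 by rewrite exprn_ge0 ?exprn_ile1 ?snk_ge0.
  have := le_trans (snk_le_tau (w - v) h0) (tau_le_norm (w - v)).
  have := snk_ge0 h (w - v); have := snk_ge0 h (w + v); have := s1 (w + v).
  have /andP[] := s2 w; have /andP[] := s2 v.
  move: (snk h w ^+ 2) (snk h v ^+ 2) (snk h (w + v)) (snk h (w - v)) (`|w - v|).
  move=> a b c d f b0 b1 a0 a1 c1 c0 d0 df.
  apply: le_trans df; have ab : 0 <= a * b <= 1 by rewrite mulr_ge0 ?mulr_ile1.
  rewrite mulrAC ler_piMl//; move: ab => /andP[ab0 ab1].
  by rewrite mulr_ile1 ?subr_ge0// lerBlDr lerDl.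
apply: (le_trans lip); near: v.
by apply: (@cvgr_dist_le _ _ _ _ _ id w) => //; exact: cvg_id.
Unshelve. all: by end_near. Qed.

(* An extremal rational function for Zolotarev's third problem on the intervals
   [[0, m]] and [[1 / m, oo]]. *)
Lemma zolotarev_nodes L k : 0 < L -> (0 < k)%N ->
  exists s : nat -> R, (forall j, 0 <= s j < 1) /\
  forall x, 0 <= x -> x ^+ 2 <= 1 - 16 * expR (- L) ->
    `|\prod_(j < k) ((x - s j) / (1 - x * s j))| <=
    2 * expR (- (pi ^+ 2 * k%:R / (2 * L))).
Proof.
move=> L0 k0; have k0R : 0 < k%:R :> R by rewrite ltr0n.
pose h := L / k%:R.
have h0 : 0 < h by rewrite divr_gt0.
have LE : k%:R * h = L by rewrite mulrC divfK// gt_eqF.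
pose v (j : nat) : R := (j%:R + 1 / 2) * h.
have H0 : 0 < 2 * L by rewrite mulr_gt0.
have snk2 u : 0 <= snk (2 * L) u ^+ 2 < 1.
  by rewrite sqr_ge0 exprn_ilt1 ?snk_ge0 ?snk_lt1.
(* The arguments of the k nodes are the odd multiples of h / 2 in [0, L], where L is half the period
   of [snk (2 * L)]. *)
exists (fun j => snk (2 * L) (v j) ^+ 2); split=> [j|x x0 xm]; first exact: snk2.
have [w ->] : exists w, x = snk (2 * L) w ^+ 2.
  have := @IVT R (fun w => snk (2 * L) w ^+ 2) 0 L x (ltW L0).
  case=> [||w _ <-]; last by exists w.
    by apply: continuous_subspaceT; exact: snk_sqr_continuous.
  have -> : snk (2 * L) 0 = 0.
    apply/eqP; rewrite eq_le snk_ge0 andbT (le_trans (snk_le_tau 0 H0))//.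
    by rewrite /tau expR0 subrr normr0 mul0r.
  have snkL : snk_max (2 * L) = snk (2 * L) L by rewrite /snk_max; congr snk; field.
  (* The lower nome bound ensures that [0, m] lies in the range of snk^2 over [0, L], as m^2 = 1 -
     16 exp (- L). *)
  have := snk_max_lower H0.
  have -> : 2 * L / 2 = L by field.
  rewrite snkL => E.
  have xle : x <= snk (2 * L) L ^+ 2.
    rewrite -(@ler_pXn2r _ 2) ?nnegrE ?sqr_ge0// -exprM /=.
    by apply: (le_trans xm); lra.
  by rewrite expr0n ge_min le_max x0 xle orbT.
apply: (@le_trans _ _ (snk_max h)); last first.
  apply: (le_trans (snk_max_upper h0)).
  rewrite ler_pM2l// ler_expR lerN2 le_eqVlt; apply/orP; left; apply/eqP.
  by rewrite /h; move: (pi ^+ 2) => p; field; rewrite !gt_eqF.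
apply: le_trans (snk_nodes_le w h0 k0).
rewrite normr_prod; apply: ler_prod => j _; rewrite normr_ge0/= LE -/(v j).
set a := snk _ w ^+ 2; set b := snk _ _ ^+ 2.
have /andP[a0 a1] : 0 <= a < 1 by exact: snk2.
have /andP[b0 b1] : 0 <= b < 1 by exact: snk2.
have ab : 0 < 1 - a * b by rewrite subr_gt0 mulr_ilt1.
rewrite normrM normfV (gtr0_norm ab) ler_pdivrMr//.
by rewrite -snk_addition.
Qed.

End Zolotarev.

(** * Separable approximation of the Cauchy kernel *)

Section CauchyKernel.
Context {R : realType}.
Implicit Types (b L x y : R) (k : nat).

(* Newton-type interpolation of the Cauchy kernel: with [p j], [q j] affine, the
   numerator [q(x) p(-y) - p(x) q(-y)] is a multiple of [x + y]. *)
Lemma cauchy_kernel_telescope (p0 p1 q0 q1 : nat -> R) k :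
  let p j z := p0 j + p1 j * z in
  let q j z := q0 j + q1 j * z in
  exists phi psi : nat -> R -> R, forall x y,
    (forall j, (j < k)%N -> q j x != 0) -> (forall j, (j < k)%N -> p j (- y) != 0) ->
    x + y != 0 ->
    (x + y)^-1 - \sum_(t < k) phi t x * psi t y =
    (\prod_(j < k) (p j x / q j x)) * (\prod_(j < k) (q j (- y) / p j (- y))) / (x + y).
Proof.
move=> p q.
exists (fun t x => (\prod_(j < t) (p j x / q j x)) / q t x).
exists (fun t y => (q1 t * p0 t - p1 t * q0 t) *
   (\prod_(j < t) (q j (- y) / p j (- y))) / p t (- y)).
move=> x y; elim: k => [|k IHk] qx py xy.
  by rewrite !big_ord0 subr0 !mul1r.
rewrite !big_ord_recr/= opprD addrA IHk//; last 2 first.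
- by move=> j jk; apply: qx; rewrite ltnS ltnW.
- by move=> j jk; apply: py; rewrite ltnS ltnW.
have {}qx := qx k (ltnSn k); have {}py := py k (ltnSn k).
set A := \prod_(_ < _) _; set B := \prod_(_ < _) _.
have -> : (q1 k * p0 k - p1 k * q0 k) =
   (q k x * p k (- y) - p k x * q k (- y)) / (x + y).
  by rewrite /p /q; field.
by field; rewrite qx py xy.
Qed.

Let cross_ratioE b : 1 < b -> 1 - 9 * b / ((b + 2) * (2 * b + 1)) =
  2 * (b - 1) ^+ 2 / ((b + 2) * (2 * b + 1)).
Proof. by move=> b1; field; rewrite !gt_eqF//; lra. Qed.

Let mobius_left b x : 1 < b -> 1 <= x <= b ->
  2 * (b + 2) / (2 * b + 1) * ((x - 1) / (x + 2)) ^+ 2 <=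
  1 - 9 * b / ((b + 2) * (2 * b + 1)).
Proof.
move=> b1 /andP[x1 xb]; rewrite cross_ratioE//.
have -> : 2 * (b - 1) ^+ 2 / ((b + 2) * (2 * b + 1)) =
    2 * (b + 2) / (2 * b + 1) * ((b - 1) / (b + 2)) ^+ 2.
  by field; rewrite !gt_eqF//; lra.
rewrite ler_wpM2l ?divr_ge0//; try lra.
rewrite ler_pXn2r ?nnegrE ?divr_ge0//; try lra.
by rewrite ler_pdivrMr 1?mulrAC 1?ler_pdivlMr; lra.
Qed.

Let mobius_right b y : 1 < b -> 2 <= y <= 2 * b ->
  ((y - 2) / (y + 1)) ^+ 2 / (2 * (b + 2) / (2 * b + 1)) <=
  1 - 9 * b / ((b + 2) * (2 * b + 1)).
Proof.
move=> b1 /andP[y2 yb]; rewrite cross_ratioE//.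
have -> : 2 * (b - 1) ^+ 2 / ((b + 2) * (2 * b + 1)) =
    ((2 * b - 2) / (2 * b + 1)) ^+ 2 / (2 * (b + 2) / (2 * b + 1)).
  by field; rewrite !gt_eqF//; lra.
rewrite ler_wpM2r ?invr_ge0 ?divr_ge0//; try lra.
rewrite ler_pXn2r ?nnegrE ?divr_ge0//; try lra.
by rewrite ler_pdivrMr 1?mulrAC 1?ler_pdivlMr; lra.
Qed.

(* The Moebius map [x |-> C (x - 1) / (x + 2)] sends [1, b] and [- 2 b, - 2] to
   [0, m] and [1 / m, oo], where [m^2 = 1 - 16 exp (- L)]. *)
Lemma cauchy_kernel_approx b k : 1 < b -> (0 < k)%N ->
  let L := ln (16 * (b + 2) * (2 * b + 1) / (9 * b)) in
  exists phi psi : nat -> R -> R, forall x y,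
    1 <= x <= b -> 2 <= y <= 2 * b ->
    `|(x + y)^-1 - \sum_(t < k) phi t x * psi t y| <=
    4 * expR (- (pi ^+ 2 * k%:R / L)) / (x + y).
Proof.
move=> b1 k0 L.
have b0 : 0 < b by lra.
have g1 : 16 < 16 * (b + 2) * (2 * b + 1) / (9 * b).
  by rewrite ltr_pdivlMr ?mulr_gt0//; nra.
have L0 : 0 < L by rewrite ln_gt0//; lra.
have eL : 16 * expR (- L) = 9 * b / ((b + 2) * (2 * b + 1)).
  rewrite expRN lnK ?posrE; last lra.
  by field; rewrite !gt_eqF//; lra.
have [s [s01 sZ]] := zolotarev_nodes L0 k0.
(* [C] balances the two intervals: t at x = b and u at y = 2b coincide, C (b - 1) / (b + 2) = 2 (b -
   1) / (C (2b + 1)). *)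
pose C := Num.sqrt (2 * (b + 2) / (2 * b + 1)).
have C2 : C ^+ 2 = 2 * (b + 2) / (2 * b + 1).
  by rewrite sqr_sqrtr// divr_ge0//; lra.
have C0 : 0 < C by rewrite sqrtr_gt0 divr_gt0//; lra.
(* Numerators and denominators of (t - s_j) / (1 - t s_j), cleared of x + 2. *)
have [phi [psi H]] := cauchy_kernel_telescope (fun j => - C - 2 * s j)
  (fun j => C - s j) (fun j => 2 + s j * C) (fun j => 1 - s j * C) k.
exists phi, psi => x y x1b y2b.
have x20 : 0 < x + 2 by case/andP: x1b => *; lra.
have y10 : 0 < y + 1 by case/andP: y2b => *; lra.
have xy0 : 0 < x + y by case/andP: x1b => *; case/andP: y2b => *; lra.
pose t := C * (x - 1) / (x + 2).
(* The reciprocal of the image of - y. Each factor (z - s_j) / (1 - z s_j) is inverted by z -> 1 /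
   z, so 1 / r(-y) is the same product at [u] and obeys the same bound. *)
pose u := (y - 2) / (C * (y + 1)).
have t0 : 0 <= t.
  by case/andP: x1b => *; rewrite divr_ge0 ?mulr_ge0 ?(ltW C0) ?(ltW x20) ?subr_ge0.
have u0 : 0 <= u.
  by case/andP: y2b => *; rewrite divr_ge0 ?mulr_ge0 ?(ltW C0) ?(ltW y10) ?subr_ge0.
have tm : t ^+ 2 <= 1 - 16 * expR (- L).
  by rewrite eL /t -mulrA exprMn C2 mobius_left.
have um : u ^+ 2 <= 1 - 16 * expR (- L).
  by rewrite eL /u invfM [_^-1 * _]mulrC mulrA exprMn exprVn C2 mobius_right.
have e0 := expR_gt0 (- L).
have lt1 z : 0 <= z -> z ^+ 2 <= 1 - 16 * expR (- L) -> z < 1.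
  by move=> z0 zm; rewrite -(@ltr_pXn2r _ 2) ?nnegrE// expr1n; lra.
have t1 := lt1 _ t0 tm; have u1 := lt1 _ u0 um.
have st (z : R) j : 0 <= z -> z < 1 -> 0 < 1 - z * s j.
  by move=> z0 z1; have /andP[] := s01 j; move: (s j) => w *; nra.
have qE j : 2 + s j * C + (1 - s j * C) * x = (x + 2) * (1 - t * s j).
  by rewrite /t; field; rewrite gt_eqF.
have pE j : - C - 2 * s j + (C - s j) * x = (x + 2) * (t - s j).
  by rewrite /t; field; rewrite gt_eqF.
have qE' j : 2 + s j * C + (1 - s j * C) * (- y) = - (C * (y + 1)) * (u - s j).
  by rewrite /u; field; rewrite (gt_eqF C0) (gt_eqF y10).
have pE' j : - C - 2 * s j + (C - s j) * (- y) = - (C * (y + 1)) * (1 - u * s j).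
  by rewrite /u; field; rewrite (gt_eqF C0) (gt_eqF y10).
have x2_neq0 : x + 2 != 0 by rewrite gt_eqF.
have y1_neq0 : - (C * (y + 1)) != 0 by rewrite oppr_eq0 mulf_neq0 ?gt_eqF.
rewrite {}H ?(gt_eqF xy0)//; last 2 first.
- by move=> j _; rewrite qE mulf_neq0// gt_eqF// st.
- by move=> j _; rewrite pE' mulf_neq0// gt_eqF// st.
rewrite normrM normfV (gtr0_norm xy0) ler_pM2r ?invr_gt0//.
rewrite (eq_bigr (fun j : 'I_k => (t - s j) / (1 - t * s j))); last first.
  by move=> j _; rewrite qE pE -mulf_div divff// mul1r.
rewrite [X in _ * X](eq_bigr (fun j : 'I_k => (u - s j) / (1 - u * s j))); last first.
  by move=> j _; rewrite qE' pE' -mulf_div divff// mul1r.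
rewrite normrM.
have -> : 4 * expR (- (pi ^+ 2 * k%:R / L)) =
  2 * expR (- (pi ^+ 2 * k%:R / (2 * L))) * (2 * expR (- (pi ^+ 2 * k%:R / (2 * L)))).
  rewrite mulrACA -expRD; congr (_ * expR _); first by ring.
  by move: (pi ^+ 2 * k%:R) => c; field; rewrite gt_eqF.
by apply: ler_pM => //; exact: sZ.
Qed.

End CauchyKernel.

(** * The discrete Laplacian *)

Section DiscreteLaplacian.
Context {R : realType}.
Implicit Types (n : nat).

Definition laplacian n : 'M[R]_n.-1 :=
  (n%:R ^+ 2 / 4) *: \matrix_(i < n.-1, j < n.-1)
    (if i == j then 2
     else if (i.+1 == j :> nat) || (j.+1 == i :> nat) then -1 else 0).

Definition laplacian_eigenvalue n (j : nat) : R :=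
  n%:R ^+ 2 * sin (pi * j.+1%:R / (2 * n%:R)) ^+ 2.

Let sine n (j : nat) (t : nat) : R := sin (pi * j.+1%:R / n%:R * t%:R).

Lemma laplacian_sym n : (laplacian n)^T = laplacian n.
Proof.
apply/matrixP => i j; rewrite !mxE eq_sym.
by case: eqP => // _; rewrite orbC.
Qed.

(* A grid function vanishing at both ends turns the truncated stencil into the
   full second difference. *)
Lemma laplacian_stencil n (s : nat -> R) (i : 'I_n.-1) : (0 < n)%N ->
  s 0%N = 0 -> s n = 0 ->
  \sum_(l < n.-1) laplacian n i l * s l.+1 =
  n%:R ^+ 2 / 4 * (2 * s i.+1 - s i - s i.+2).
Proof.
move=> n0 s0 sn.
have delta (t : nat) (F : nat -> R) (c : bool) : ((t < n.-1)%N = c) ->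
    \sum_(l < n.-1) (if (l == t :> nat) then F l else 0) = if c then F t else 0.
  move=> tc; rewrite -big_mkcond/=; case: c tc => tn.
    by rewrite (big_pred1 (Ordinal tn)) // => l; rewrite -val_eqE.
  by rewrite big_pred0// => l; apply/negP => /eqP lt; have := ltn_ord l; rewrite lt tn.
transitivity (n%:R ^+ 2 / 4 * (\sum_(l < n.-1) (if (l == i :> nat) then 2 * s l.+1 else 0)
  - \sum_(l < n.-1) (if (l.+1 == i :> nat) then s l.+1 else 0)
  - \sum_(l < n.-1) (if (l == i.+1 :> nat) then s l.+1 else 0))).
  rewrite -!sumrB mulr_sumr; apply: eq_bigr => l _; rewrite !mxE -!mulrA; congr (_ * (_ * _)).
  rewrite -val_eqE [val i == _]eq_sym (eq_sym i.+1).
  have [->|li] := eqVneq (l : nat) i.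
    by rewrite ?(gtn_eqF (ltnSn i)) ?(ltn_eqF (ltnSn i)) ?subr0.
  have [E|li1] := eqVneq (l : nat) i.+1.
    have -> : (l.+1 == i) = false by apply/negP => /eqP; rewrite E; lia.
    by rewrite /= subr0 sub0r mulN1r.
  have [li2|li2] := eqVneq l.+1 (i : nat).
    by rewrite /= sub0r subr0 mulN1r.
  by rewrite /= !subr0 mul0r.
congr (_ * _); congr (_ - _ - _).
- by rewrite (delta i (fun l => 2 * s l.+1) true) ?ltn_ord.
- have := ltn_ord i; case: (nat_of_ord i) => [|j] ji; first by rewrite s0 big1.
  by rewrite (delta j (fun l => s l.+1) true)// ltnW.
- rewrite (delta i.+1 (fun l => s l.+1) (i.+1 < n.-1)%N)//.
  case: ltnP => // ni; rewrite (_ : i.+2 = n) ?sn//.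
  by have := ltn_ord i; lia.
Qed.

Lemma laplacian_sine n (j : nat) (i : 'I_n.-1) : (0 < n)%N ->
  \sum_(l < n.-1) laplacian n i l * sine n j l.+1 =
  laplacian_eigenvalue n j * sine n j i.+1.
Proof.
move=> n0; have nR : n%:R != 0 :> R by rewrite pnatr_eq0 -lt0n.
rewrite laplacian_stencil//; last 2 first.
- by rewrite /sine mulr0 sin0.
- rewrite /sine divfK//.
  elim: j => [|j IHj]; first by rewrite mulr1 sinpi.
  by rewrite -natr1 mulrDr mulr1 sinDpi IHj oppr0.
pose th : R := pi * j.+1%:R / n%:R.
have E : pi * j.+1%:R / (2 * n%:R) = th / 2.
  by rewrite /th; move: (pi) => p; field.
have cosE : cos th = 1 - 2 * sin (th / 2) ^+ 2.
  have -> : cos th = cos ((th / 2) *+ 2) by congr cos; rewrite -mulr_natr divfK.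
  by rewrite cos_mulr2n cos2sin2; ring.
have e1 : sine n j i = sin (th * i.+1%:R - th).
  by rewrite /sine -/th; congr sin; rewrite -natr1; ring.
have e2 : sine n j i.+2 = sin (th * i.+1%:R + th).
  by rewrite /sine -/th; congr sin; rewrite -!natr1; ring.
rewrite e1 e2 sinB sinD {1 2}/sine -/th cosE /laplacian_eigenvalue E.
by field.
Qed.

Let angle n (j : nat) : R := pi * j.+1%:R / (2 * n%:R).

Let angle_itv n (j : 'I_n.-1) : 0 < angle n j < pi / 2.
Proof.
have n0 : (0 < n)%N by have := ltn_ord j; lia.
have nR : 0 < n%:R :> R by rewrite ltr0n.
rewrite /angle divr_gt0 ?mulr_gt0 ?pi_gt0//=.
rewrite invfM mulrA [pi / 2]mulrC [pi * _ / 2]mulrAC ltr_pdivrMr//.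
rewrite [_^-1 * pi]mulrC ltr_pM2l ?divr_gt0 ?pi_gt0// ltr_nat.
by have := ltn_ord j; lia.
Qed.

(** At x = pi / (2n) it yields 1 <= n sin x, the lower bound of the spectrum. *)
Lemma norm_sin_natmul_le n (x : R) : `|sin (n%:R * x)| <= n%:R * `|sin x|.
Proof.
elim: n => [|n IHn]; first by rewrite !mul0r sin0 normr0.
rewrite -natr1 !mulrDl !mul1r sinD (le_trans (ler_normD _ _))// !normrM lerD//.
  by apply: le_trans IHn; rewrite ler_piMr// cos_max.
by rewrite ler_piMl// cos_max.
Qed.

Lemma laplacian_eigenvalue_bounds n (j : 'I_n.-1) :
  1 <= laplacian_eigenvalue n j <= n%:R ^+ 2.
Proof.
have n0 : (1 < n)%N by have := ltn_ord j; lia.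
have nR : 0 < n%:R :> R by rewrite ltr0n ltnW.
have /andP[a0 a1] := angle_itv j.
rewrite /laplacian_eigenvalue -/(angle n j); apply/andP; split; last first.
  by rewrite ler_piMr ?sqr_ge0// -(real_normK (num_real _)) exprn_ile1// sin_max.
rewrite -exprMn exprn_ege1//.
have b0 : 0 < angle n 0 <= angle n j.
  rewrite /angle divr_gt0 ?mulr_gt0 ?pi_gt0//=.
  by rewrite ler_pM2r ?invr_gt0 ?mulr_gt0// ler_pM2l ?pi_gt0// ler_nat.
have /andP[b1 b2] := b0.
have s0 : 0 < sin (angle n 0) by rewrite sin_gt0_pihalf// b1; lra.
have H : 1 <= n%:R * sin (angle n 0).
  have := norm_sin_natmul_le n (angle n 0).
  have -> : n%:R * angle n 0 = pi / 2.
    by rewrite /angle mulr1; move: (pi) => p; field; rewrite gt_eqF.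
  by rewrite sin_pihalf normr1 (gtr0_norm s0).
apply: (le_trans H); rewrite ler_pM2l//.
move: b2; rewrite le_eqVlt => /predU1P[->//|b2].
by rewrite ltW// ltr_sin// in_itv/=; apply/andP; split; lra.
Qed.

Lemma laplacian_eigenvalue_inj n : injective (fun j : 'I_n.-1 => laplacian_eigenvalue n j).
Proof.
move=> i j; rewrite /laplacian_eigenvalue -!/(angle n _).
have n0 : (1 < n)%N by have := ltn_ord j; lia.
have nR : n%:R != 0 :> R by rewrite pnatr_eq0 -lt0n ltnW.
have /andP[a0 a1] := angle_itv j; have /andP[b0 b1] := angle_itv i.
move=> /(mulfI (expf_neq0 2 nR))/eqP.
rewrite eqrXn2 ?ltW ?sin_gt0_pihalf ?a0 ?b0// => /eqP /sin_inj.
rewrite !in_itv/= => H.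
have {H} : angle n i = angle n j by apply: H; apply/andP; split; lra.
move=> /(mulIf (invr_neq0 (mulf_neq0 _ nR))) H.
have {H} : pi * i.+1%:R = pi * j.+1%:R :> R by apply: H.
move=> /(mulfI (lt0r_neq0 (@pi_gt0 R)))/eqP.
by rewrite eqr_nat eqSS => /eqP /val_inj.
Qed.

(** No trigonometric sums are evaluated: eigenvectors of a symmetric matrix for distinct eigenvalues
    are orthogonal, and the sine vectors can be normalised because their first entries are
    positive. *)
Lemma laplacian_eigenbasis n : exists U : 'M[R]_n.-1,
  U *m U^T = 1%:M /\ forall a l,
    \sum_(i < n.-1) U a i * laplacian n i l = laplacian_eigenvalue n a * U a l.
Proof.
have symK i l : laplacian n i l = laplacian n l i.
  by rewrite -{1}laplacian_sym mxE.
pose W : 'M[R]_n.-1 := \matrix_(a, i) sine n a i.+1.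
have WK a l : \sum_(i < n.-1) W a i * laplacian n i l = laplacian_eigenvalue n a * W a l.
  have n0 : (0 < n)%N by have := ltn_ord a; lia.
  rewrite mxE -laplacian_sine//; apply: eq_bigr => i _.
  by rewrite mxE mulrC symK.
pose G a b := \sum_(i < n.-1) W a i * W b i.
have Gdiag a : 0 < G a a.
  have n0 : (1 < n)%N by have := ltn_ord a; lia.
  have i0 : (0 < n.-1)%N by lia.
  rewrite /G (bigD1 (Ordinal i0))//=; apply: ltr_pwDl; last first.
    by apply: sumr_ge0 => i _; rewrite -expr2 sqr_ge0.
  rewrite -expr2 exprn_gt0// mxE /sine mulr1 sin_gt0_pi//.
  have := angle_itv a; have -> : pi * a.+1%:R / n%:R = 2 * angle n a.
    rewrite /angle; move: (pi) => p; field.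
    by rewrite pnatr_eq0 -lt0n ltnW.
  by move=> /andP[? ?]; apply/andP; split; lra.
have Goff a b : a != b -> G a b = 0.
  move=> ab.
  have E : laplacian_eigenvalue n a * G a b = laplacian_eigenvalue n b * G a b.
    rewrite /G !mulr_sumr.
    transitivity (\sum_l \sum_i W a i * laplacian n i l * W b l).
      by apply: eq_bigr => l _; rewrite mulrA -WK mulr_suml.
    rewrite exchange_big/=; apply: eq_bigr => i _.
    rewrite mulrCA -WK mulr_sumr; apply: eq_bigr => l _.
    by rewrite (symK i l); ring.
  have : (laplacian_eigenvalue n a - laplacian_eigenvalue n b) * G a b = 0.
    by rewrite mulrBl E subrr.
  move/eqP; rewrite mulf_eq0 subr_eq0 => /orP[/eqP/laplacian_eigenvalue_inj/eqP|/eqP//].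
  by rewrite (negbTE ab).
exists (\matrix_(a, i) (W a i / Num.sqrt (G a a))); split.
  apply/matrixP => a b; rewrite !mxE.
  transitivity (G a b / (Num.sqrt (G a a) * Num.sqrt (G b b))).
    rewrite /G mulr_suml; apply: eq_bigr => i _; rewrite !mxE invfM; ring.
  have [<-|ab] := eqVneq a b; last by rewrite Goff// mul0r.
  by rewrite -expr2 sqr_sqrtr ?ltW// divff// gt_eqF.
move=> a l; rewrite mxE mulrA -WK mulr_suml; apply: eq_bigr => i _.
by rewrite mxE; ring.
Qed.

End DiscreteLaplacian.

(** * Transforms and projections of tensors with three modes *)

Section OrthogonalTransform.
Context {R : realType} {m : nat}.
Implicit Types (U : 'M[R]_m) (x h : 'I_m -> 'I_m -> 'I_m -> R).

Definition sum3 (F : 'I_m -> 'I_m -> 'I_m -> R) : R :=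
  \sum_i \sum_j \sum_k F i j k.

(* The sums are nested in the opposite order to those of [bwd3], so that the
   two transforms cancel from the inside. *)
Definition fwd3 U x a b c : R :=
  \sum_k U c k * \sum_j U b j * \sum_i U a i * x i j k.

Definition bwd3 U h i j k : R :=
  \sum_a U a i * \sum_b U b j * \sum_c U c k * h a b c.

Section Orthogonal.
Variable U : 'M[R]_m.
Hypothesis UU : U *m U^T = 1%:M.

Lemma orth_rows a b : \sum_i U a i * U b i = (a == b)%:R.
Proof.
have := congr1 (fun M : 'M[R]_m => M a b) UU; rewrite !mxE => <-.
by apply: eq_bigr => i _; rewrite mxE.
Qed.

Lemma orth_cols i j : \sum_a U a i * U a j = (i == j)%:R.
Proof.
have := congr1 (fun M : 'M[R]_m => M i j) (mulmx1C UU); rewrite !mxE => <-.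
by apply: eq_bigr => a _; rewrite mxE.
Qed.

Lemma orth_inverse (v : 'I_m -> R) i : \sum_a U a i * \sum_j U a j * v j = v i.
Proof.
under eq_bigr do rewrite mulr_sumr.
rewrite exchange_big/=.
transitivity (\sum_j (i == j)%:R * v j).
  apply: eq_bigr => j _; rewrite -orth_cols mulr_suml.
  by apply: eq_bigr => a _; rewrite mulrA.
rewrite (bigD1 i)//= eqxx mul1r big1 ?addr0// => j ji.
by rewrite eq_sym (negbTE ji) mul0r.
Qed.

Lemma orth_norm (v : 'I_m -> R) :
  \sum_i (\sum_a U a i * v a) ^+ 2 = \sum_a v a ^+ 2.
Proof.
transitivity (\sum_i \sum_a (v a * U a i) * \sum_b U b i * v b).
  apply: eq_bigr => i _; rewrite expr2 mulr_suml.
  by apply: eq_bigr => a _; rewrite [U a i * _]mulrC.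
rewrite exchange_big/=; apply: eq_bigr => a _.
have vE : \sum_b (a == b)%:R * v b = v a.
  rewrite (bigD1 a)//= eqxx mul1r big1 ?addr0// => j ji.
  by rewrite eq_sym (negbTE ji) mul0r.
rewrite expr2 -[X in _ = _ * X]vE mulr_sumr.
under eq_bigr do rewrite mulr_sumr.
rewrite exchange_big/=; apply: eq_bigr => b _.
rewrite -orth_rows mulr_suml mulr_sumr; apply: eq_bigr => i _; ring.
Qed.

Lemma bwd3K x i j k : bwd3 U (fwd3 U x) i j k = x i j k.
Proof.
rewrite /bwd3 /fwd3.
under eq_bigr do under eq_bigr do rewrite orth_inverse.
under eq_bigr do rewrite orth_inverse.
exact: orth_inverse.
Qed.

Lemma bwd3_norm h :
  sum3 (fun i j k => bwd3 U h i j k ^+ 2) = sum3 (fun a b c => h a b c ^+ 2).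
Proof.
rewrite /sum3 /bwd3 exchange_big/=.
under eq_bigr do rewrite exchange_big/=.
under eq_bigr do under eq_bigr do rewrite orth_norm.
under eq_bigr do rewrite exchange_big/=.
rewrite exchange_big/=; apply: eq_bigr => a _.
rewrite exchange_big/=.
under eq_bigr do rewrite orth_norm.
rewrite exchange_big/=; apply: eq_bigr => b _.
exact: orth_norm.
Qed.

Lemma bwd3_eq h h' : (forall a b c, h a b c = h' a b c) ->
  forall i j k, bwd3 U h i j k = bwd3 U h' i j k.
Proof.
move=> hh' i j k; apply: eq_bigr => a _; congr (_ * _); apply: eq_bigr => b _.
by congr (_ * _); apply: eq_bigr => c _; rewrite hh'.
Qed.

Lemma bwd3B h h' i j k :
  bwd3 U (fun a b c => h a b c - h' a b c) i j k =
  bwd3 U h i j k - bwd3 U h' i j k.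
Proof.
rewrite /bwd3 -sumrB; apply: eq_bigr => a _; rewrite -mulrBr; congr (_ * _).
rewrite -sumrB; apply: eq_bigr => b _; rewrite -mulrBr; congr (_ * _).
by rewrite -sumrB; apply: eq_bigr => c _; rewrite -mulrBr.
Qed.

End Orthogonal.

Definition kron_sum_eq (K : 'M[R]_m) x (r : R) :=
  forall i j k, \sum_l K i l * x l j k + \sum_l K j l * x i l k +
                \sum_l K k l * x i j l = r.

(** In the eigenbasis the operator is diagonal, so every solution has this form. The constant [r] is
    1 for the real part of the tensor and 0 for its imaginary part. *)
Lemma kron_sum_solution U (K : 'M[R]_m) (lam : 'I_m -> R) x (r : R) :
  U *m U^T = 1%:M ->
  (forall a l, \sum_i U a i * K i l = lam a * U a l) ->
  (forall a, 0 < lam a) -> kron_sum_eq K x r ->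
  forall i j k, x i j k = bwd3 U (fun a b c =>
    r * ((\sum_l U a l) * (\sum_l U b l) * (\sum_l U c l)) /
    (lam a + lam b + lam c)) i j k.
Proof.
move=> UU UK lam0 xr i j k; rewrite -[LHS](bwd3K UU).
apply: bwd3_eq => a b c {i j k}.
have eig (v : 'I_m -> R) a' : \sum_i U a' i * \sum_l K i l * v l =
    lam a' * \sum_l U a' l * v l.
  under eq_bigr do rewrite mulr_sumr.
  rewrite exchange_big/= mulr_sumr; apply: eq_bigr => l _.
  rewrite mulrA -UK mulr_suml; apply: eq_bigr => i _; ring.
have swap (v : 'I_m -> 'I_m -> R) (w : 'I_m -> R) a' : \sum_i U a' i * \sum_l w l * v i l =
    \sum_l w l * \sum_i U a' i * v i l.
  under eq_bigr do rewrite mulr_sumr.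
  rewrite exchange_big/=; apply: eq_bigr => l _; rewrite mulr_sumr.
  by apply: eq_bigr => i _; ring.
have E : (lam a + lam b + lam c) * fwd3 U x a b c =
    r * ((\sum_l U a l) * (\sum_l U b l) * (\sum_l U c l)).
  transitivity (fwd3 U (fun i j k => \sum_l K i l * x l j k + \sum_l K j l * x i l k +
                \sum_l K k l * x i j l) a b c); last first.
    rewrite /fwd3; under eq_bigr do under eq_bigr do under eq_bigr do rewrite xr.
    under eq_bigr do under eq_bigr do rewrite -mulr_suml.
    under eq_bigr do rewrite -mulr_suml.
    by rewrite -mulr_suml; ring.
  have fwdD y z : fwd3 U (fun i j k => y i j k + z i j k) a b c =
      fwd3 U y a b c + fwd3 U z a b c.
    rewrite /fwd3 -big_split/=; apply: eq_bigr => k _; rewrite -mulrDr; congr (_ * _).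
    rewrite -big_split/=; apply: eq_bigr => j _; rewrite -mulrDr; congr (_ * _).
    by rewrite -big_split/=; apply: eq_bigr => i _; rewrite -mulrDr.
  rewrite !fwdD !mulrDl; congr (_ + _ + _).
  - rewrite /fwd3 mulr_sumr; apply: eq_bigr => k _.
    rewrite mulrCA; congr (_ * _); rewrite mulr_sumr; apply: eq_bigr => j _.
    by rewrite mulrCA eig.
  - rewrite /fwd3 mulr_sumr; apply: eq_bigr => k _.
    rewrite mulrCA; congr (_ * _).
    under [RHS]eq_bigr do rewrite (swap (fun i l => x i l k)).
    by rewrite eig.
  - rewrite /fwd3 -eig; apply: eq_bigr => k _; congr (_ * _).
    under [RHS]eq_bigr do rewrite (swap (fun i l => x i _ l)).
    by rewrite (swap (fun j l => \sum_i U a i * x i j l)).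
rewrite -E [_ * fwd3 _ _ _ _ _]mulrC mulfK// gt_eqF//.
by rewrite !addr_gt0.
Qed.

End OrthogonalTransform.

Section Projection.
Context {R : realType}.

Definition sqnorm {m} (v : 'rV[R]_m) : R := \sum_i v 0 i ^+ 2.

Lemma sqnorm_mx m (v : 'rV[R]_m) : sqnorm v = (v *m v^T) 0 0.
Proof. by rewrite mxE; apply: eq_bigr => i _; rewrite mxE expr2. Qed.

Lemma row_free_gram m r (W : 'M[R]_(r, m)) : row_free W -> W *m W^T \in unitmx.
Proof.
move=> fW; rewrite -row_free_unit -kermx_eq0.
set N := kermx _; have : N *m (W *m W^T) *m N^T = 0 by rewrite mulmx_ker mul0mx.
rewrite !mulmxA -mulmxA -trmx_mul => H.
have : N *m W = 0.
  apply/row_matrixP => i; rewrite row0; apply/rowP => j; rewrite !mxE.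
  have := congr1 (fun M : 'M[R]_r => M i i) H; rewrite !mxE => /eqP.
  under eq_bigr do rewrite !mxE -expr2.
  rewrite psumr_eq0; last by move=> k _; rewrite sqr_ge0.
  by move=> /allP /(_ j (mem_index_enum _)) /=; rewrite sqrf_eq0 => /eqP.
by move/eqP; rewrite mulmx_free_eq0.
Qed.

(** The projector W^T (W W^T)^-1 W for a row basis W of V, kept factored through dimension r because
    r becomes the tensor-train rank. *)
Lemma row_space_projection m k (V : 'M[R]_(k, m)) :
  exists r (W Q : 'M[R]_(r, m)), (r <= k)%N /\
    let P := W^T *m Q in [/\ P^T = P, P *m P = P & V *m P = V].
Proof.
have [W fW VW] : exists2 W : 'M[R]_(\rank V, m), row_free W & (V <= W)%MS.
  by exists (row_base V); rewrite ?row_base_free ?eq_row_base.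
pose G := W *m W^T.
have GU : G \in unitmx by exact: row_free_gram.
exists (\rank V), W, (invmx G *m W); split; first exact: rank_leq_row.
have GT : G^T = G by rewrite trmx_mul trmxK.
have WP : W *m (W^T *m (invmx G *m W)) = W by rewrite !mulmxA mulmxV// mul1mx.
split.
- by rewrite !trmx_mul trmxK trmx_inv GT mulmxA.
- by rewrite -mulmxA -(mulmxA (invmx G)) WP.
- have /submxP[M VE] := VW.
  by rewrite [X in X *m _ = _]VE [RHS]VE -mulmxA WP.
Qed.

Lemma projection_pythagoras m (P : 'M[R]_m) (v w : 'rV[R]_m) :
  P^T = P -> P *m P = P ->
  sqnorm ((v - v *m P) + w *m P) = sqnorm (v - v *m P) + sqnorm (w *m P).
Proof.
move=> PT PP; have vPP : (v - v *m P) *m P = 0.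
  by rewrite mulmxBl -mulmxA PP subrr.
have o : (v - v *m P) *m (w *m P)^T = 0 by rewrite trmx_mul PT mulmxA vPP mul0mx.
have o' : (w *m P) *m (v - v *m P)^T = 0.
  by have := congr1 trmx o; rewrite trmx_mul trmxK trmx0.
by rewrite !sqnorm_mx linearD mulmxDl !mulmxDr o o' add0r addr0 mxE.
Qed.

Lemma projection_norm_le m (P : 'M[R]_m) (v : 'rV[R]_m) :
  P^T = P -> P *m P = P -> sqnorm (v *m P) <= sqnorm v.
Proof.
move=> PT PP; have := projection_pythagoras v v PT PP; rewrite subrK => ->.
by rewrite lerDr sumr_ge0// => i _; rewrite sqr_ge0.
Qed.

Lemma projection_best m (P : 'M[R]_m) (v u : 'rV[R]_m) :
  P^T = P -> P *m P = P -> u *m P = u -> sqnorm (v - v *m P) <= sqnorm (v - u).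
Proof.
move=> PT PP uP; have := projection_pythagoras v (v - u) PT PP.
rewrite mulmxBl uP addrA subrK => ->.
by rewrite lerDl sumr_ge0// => i _; rewrite sqr_ge0.
Qed.

End Projection.

(** * Low-rank approximation of solutions of Kronecker-sum equations *)

Section KroneckerSum.
Context {R : realType}.

Lemma sum3_rot {m} (F : 'I_m -> 'I_m -> 'I_m -> R) :
  sum3 F = \sum_b \sum_c \sum_a F a b c.
Proof.
rewrite /sum3 exchange_big/=; apply: eq_bigr => b _; exact: exchange_big.
Qed.

Lemma kron_sum_tt_approx {m} (U K : 'M[R]_m) (lam : 'I_m -> R)
    (b : R) (k : nat) x :
  U *m U^T = 1%:M ->
  (forall a l, \sum_i U a i * K i l = lam a * U a l) ->
  (forall a, 1 <= lam a <= b) -> kron_sum_eq K x 1 -> 1 < b -> (0 < k)%N ->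
  let L := ln (16 * (b + 2) * (2 * b + 1) / (9 * b)) in
  exists (r : nat) (A : 'M[R]_(m, r)) (B : 'I_m -> 'M[R]_r), (r <= k)%N /\
    sum3 (fun i j l => (x i j l - (A *m B j *m A^T) i l) ^+ 2) <=
    2 * (4 * expR (- (pi ^+ 2 * k%:R / L))) ^+ 2 *
      sum3 (fun i j l => x i j l ^+ 2).
Proof.
move=> UU UK lamb xK b1 k0 L.
have [phi [psi happ]] := cauchy_kernel_approx b1 k0.
rewrite -/L in happ; set Z := 4 * expR _ in happ *.
have Z0 : 0 <= Z by rewrite mulr_ge0// expR_ge0.
pose g a := \sum_l U a l.
pose H a c d := 1 * (g a * g c * g d) / (lam a + lam c + lam d).
have lam0 a : 0 < lam a by have /andP[? _] := lamb a; lra.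
have xH := kron_sum_solution UU UK lam0 xK.
(* The row space contains the separable approximant of every fibre, whatever its two fixed indices
   and along mode 1 as well as mode 3. *)
pose V : 'M[R]_(k, m) := \matrix_(t, a) (g a * phi t (lam a)).
have [r [W [Q [rk]]]] := row_space_projection V.
set P := W^T *m Q; case=> PT PP VP.
have fiber (v : 'rV[R]_m) (kap mu : R) : 2 <= mu <= 2 * b ->
    (forall a, v 0 a = g a * kap / (lam a + mu)) ->
    sqnorm (v - v *m P) <= Z ^+ 2 * sqnorm v.
  move=> mub vE; pose u := (\row_(t < k) (kap * psi t mu)) *m V.
  have uP : u *m P = u by rewrite -mulmxA VP.
  apply: le_trans (projection_best v PT PP uP) _.
  rewrite /sqnorm mulr_sumr; apply: ler_sum => a _.
  have -> : (v - u) 0 a = g a * kap * ((lam a + mu)^-1 - \sum_(t < k) phi t (lam a) * psi t mu).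
    rewrite !mxE vE mulrBr; congr (_ - _); rewrite mulr_sumr; apply: eq_bigr => t _.
    by rewrite !mxE; ring.
  rewrite vE exprMn.
  rewrite (_ : Z ^+ 2 * _ = (g a * kap) ^+ 2 * (Z / (lam a + mu)) ^+ 2); last first.
    by rewrite -!exprMn; congr (_ ^+ 2); ring.
  rewrite ler_wpM2l ?sqr_ge0//.
  rewrite -(real_normK (num_real (_ - _))) ler_pXn2r// ?nnegrE.
    exact: happ.
  by rewrite divr_ge0// addr_ge0 ?(ltW (lam0 a))//; case/andP: mub => ? _; lra.
have mub c d : 2 <= lam c + lam d <= 2 * b.
  by have /andP[? ?] := lamb c; have /andP[? ?] := lamb d; apply/andP; split; lra.
pose Hm c : 'M[R]_m := \matrix_(a, d) H a c d.
(* The r x r middle core; since Q^T W = P^T, [Hhat] is H projected in both outer modes. *)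
pose Mc c := W *m Hm c *m W^T.
pose Hhat a c d := (Q^T *m Mc c *m Q) a d.
pose H3 a c d := (Hm c *m P) a d.
have HhatE a c d : Hhat a c d = \sum_e H3 e c d * P e a.
  rewrite /Hhat /Mc.
  have -> : Q^T *m (W *m Hm c *m W^T) *m Q = P^T *m (Hm c *m P).
    by rewrite /P trmx_mul trmxK !mulmxA.
  by rewrite mxE; apply: eq_bigr => e _; rewrite mxE mulrC.
have err3 : sum3 (fun a c d => (H a c d - H3 a c d) ^+ 2) <=
    Z ^+ 2 * sum3 (fun a c d => H a c d ^+ 2).
  rewrite /sum3 mulr_sumr; apply: ler_sum => a _.
  rewrite mulr_sumr; apply: ler_sum => c _.
  have := @fiber (row a (Hm c)) (g a * g c) (lam a + lam c) (mub a c).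
  have -> : sqnorm (row a (Hm c)) = \sum_d H a c d ^+ 2.
    by apply: eq_bigr => d _; rewrite !mxE.
  have -> : sqnorm (row a (Hm c) - row a (Hm c) *m P) = \sum_d (H a c d - H3 a c d) ^+ 2.
    by apply: eq_bigr => d _; rewrite -row_mul /H3 !mxE.
  apply => d; rewrite !mxE /H mul1r [lam d + _]addrC.
  by rewrite [g d * _]mulrC.
have errH : sum3 (fun a c d => (H a c d - Hhat a c d) ^+ 2) <=
    2 * Z ^+ 2 * sum3 (fun a c d => H a c d ^+ 2).
  rewrite -[2]/(1 + 1) mulrDl mul1r mulrDl.
  apply: le_trans (lerD (lexx _) err3).
  rewrite !sum3_rot mulr_sumr -big_split/=; apply: ler_sum => c _.
  rewrite mulr_sumr -big_split/=; apply: ler_sum => d _.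
  pose v : 'rV[R]_m := \row_a H a c d.
  pose w : 'rV[R]_m := \row_a (H a c d - H3 a c d).
  (* The error is the mode-1 error of v plus the projection of the mode-3 error w; the two are
     orthogonal. *)
  have -> : \sum_a (H a c d - Hhat a c d) ^+ 2 = sqnorm ((v - v *m P) + w *m P).
    apply: eq_bigr => a _; rewrite HhatE !mxE; congr (_ ^+ 2).
    rewrite -addrA; congr (_ + _); rewrite addrC -sumrB -sumrN; apply: eq_bigr => e _.
    by rewrite !mxE; ring.
  rewrite projection_pythagoras//; apply: lerD.
    have -> : \sum_a H a c d ^+ 2 = sqnorm v by apply: eq_bigr => a _; rewrite mxE.
    apply: (fiber v (g c * g d) (lam c + lam d) (mub c d)) => a.
    by rewrite mxE /H mul1r addrA mulrA.
  apply: le_trans (projection_norm_le w PT PP) _.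
  by apply: ler_sum => a _; rewrite mxE.
exists r, (U^T *m Q^T), (fun j => \sum_c U c j *: Mc c); split => //.
have yE i j l : (U^T *m Q^T *m (\sum_c U c j *: Mc c) *m (U^T *m Q^T)^T) i l =
    bwd3 U Hhat i j l.
  rewrite mulmx_sumr mulmx_suml summxE /bwd3.
  under [RHS]eq_bigr do rewrite mulr_sumr.
  rewrite [RHS]exchange_big/=; apply: eq_bigr => c _.
  rewrite -scalemxAr -scalemxAl mxE trmx_mul !trmxK.
  have -> : U^T *m Q^T *m Mc c *m (Q *m U) = U^T *m ((Q^T *m Mc c *m Q) *m U).
    by rewrite !mulmxA.
  rewrite mxE mulr_sumr; apply: eq_bigr => a _.
  rewrite !mxE mulrCA; congr (_ * (_ * _)); apply: eq_bigr => d _.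
  by rewrite mulrC.
rewrite (_ : sum3 _ = sum3 (fun i j l => bwd3 U (fun a c d => H a c d - Hhat a c d) i j l ^+ 2)).
  rewrite bwd3_norm//.
  rewrite (_ : sum3 (fun i j l => x i j l ^+ 2) = sum3 (fun a c d => H a c d ^+ 2))//.
  rewrite -(bwd3_norm UU H); apply: eq_bigr => i _; apply: eq_bigr => j _.
  by apply: eq_bigr => l _; rewrite xH.
apply: eq_bigr => i _; apply: eq_bigr => j _; apply: eq_bigr => l _.
by rewrite bwd3B// xH yE.
Qed.

End KroneckerSum.

(** * Tensor trains *)

Section ThreeTensors.
Local Open Scope complex_scope.
Context {R : realType} {m : nat}.

Let o0 : 'I_3 := @Ordinal 3 0 isT.
Let o1 : 'I_3 := @Ordinal 3 1 isT.
Let o2 : 'I_3 := @Ordinal 3 2 isT.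

Definition index3 (i j l : 'I_m) : mindex (fun _ : 'I_3 => m) :=
  [ffun k : 'I_3 => if k == o0 then i else if k == o1 then j else l].

Lemma index3K (I : mindex (fun _ : 'I_3 => m)) : index3 (I o0) (I o1) (I o2) = I.
Proof.
apply/ffunP => k; rewrite ffunE.
case: eqP => [->//|k0]; case: eqP => [->//|k1].
suff -> : k = o2 by [].
apply: val_inj; case: k k0 k1 => -[|[|[|k]]] //= p k0 k1.
- by case: k0; exact: val_inj.
- by case: k1; exact: val_inj.
Qed.

Lemma index3E i j l : (index3 i j l o0 = i) * (index3 i j l o1 = j) * (index3 i j l o2 = l).
Proof. by rewrite !ffunE. Qed.

Lemma sum_mindex3 (F : mindex (fun _ : 'I_3 => m) -> R) :
  \sum_I F I = sum3 (fun i j l => F (index3 i j l)).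
Proof.
rewrite /sum3 (reindex (fun p : 'I_m * ('I_m * 'I_m) => index3 p.1 p.2.1 p.2.2))/=.
  rewrite -(pair_bigA _ (fun i p => F (index3 i p.1 p.2)))/=.
  by apply: eq_bigr => i _; rewrite -(pair_bigA _ (fun j l => F (index3 i j l))).
exists (fun I => (I o0, (I o1, I o2))) => [[i [j l]] _|I _] /=.
  by rewrite !index3E.
exact: index3K.
Qed.

Lemma dfwith_index3 i j l t :
  (finfun (@eqtype.dfwith _ (fun _ : 'I_3 => 'I_m) (index3 i j l) o0 t) = index3 t j l) *
  (finfun (@eqtype.dfwith _ (fun _ : 'I_3 => 'I_m) (index3 i j l) o1 t) = index3 i t l) *
  (finfun (@eqtype.dfwith _ (fun _ : 'I_3 => 'I_m) (index3 i j l) o2 t) = index3 i j t).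
Proof.
have H (k k' : 'I_3) : @eqtype.dfwith _ (fun _ : 'I_3 => 'I_m) (index3 i j l) k t k' =
   if k == k' then t else index3 i j l k'.
  have [<-|kk'] := eqVneq k k'; first exact: eqtype.dfwith_in.
  exact: eqtype.dfwith_out.
by split; [split|]; apply/ffunP => k; rewrite !ffunE H ffunE;
  case: k => -[|[|[|k]]].
Qed.

Lemma mode_prod_index3 (X : tensor R (fun _ : 'I_3 => m)) (A : 'M[R[i]]_m) i j l :
  (mode_prod X (k := o0) A (index3 i j l) = \sum_t X (index3 t j l) * A i t) *
  (mode_prod X (k := o1) A (index3 i j l) = \sum_t X (index3 i t l) * A j t) *
  (mode_prod X (k := o2) A (index3 i j l) = \sum_t X (index3 i j t) * A l t).
Proof.
split; [split|]; rewrite ffunE index3E; apply: eq_bigr => t _;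
  by rewrite dfwith_index3.
Qed.

Definition tt3_rank (r k : nat) : nat :=
  match k with 1%N | 2%N => r | _ => 1%N end.

(** The nested matches let the shape of each core compute; the last branch lies outside ['I_3]. *)
Definition tt3_cores (r : nat) (A : 'M[R[i]]_(m, r)) (B : 'I_m -> 'M[R[i]]_r)
    (C : 'M[R[i]]_(r, m)) (k : 'I_3) :
    'I_m -> 'M[R[i]]_(tt3_rank r k, tt3_rank r k.+1) :=
  match k as k' return 'I_m -> 'M[R[i]]_(tt3_rank r k', tt3_rank r k'.+1) with
  | Ordinal k0 _ =>
    match k0 as k1 return 'I_m -> 'M[R[i]]_(tt3_rank r k1, tt3_rank r k1.+1) with
    | 0%N => fun i => row i A
    | 1%N => fun j => B j
    | 2%N => fun l => col l C
    | _ => fun=> 0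
    end
  end.

Lemma tt3_rank_le (r : nat) (A : 'M[R[i]]_(m, r)) (B : 'I_m -> 'M[R[i]]_r)
    (C : 'M[R[i]]_(r, m)) (Y : tensor R (fun _ : 'I_3 => m)) :
  (forall i j l, Y (index3 i j l) = (A *m B j *m C) i l) ->
  tt_rank_le (tt3_rank r) Y.
Proof.
move=> YE; split => //; exists (tt3_cores A B C) => I.
rewrite -(index3K I) YE; move: (I o0) (I o1) (I o2) => i j l {I}.
rewrite [LHS]/=.
have eo0 p : @Ordinal 3 0 p = o0 by exact: val_inj.
have eo1 p : @Ordinal 3 1 p = o1 by exact: val_inj.
have eo2 p : @Ordinal 3 2 p = o2 by exact: val_inj.
rewrite eo0 eo1 eo2 !index3E mul1mx.
have E : row i A *m B j *m col l C = row i (col l (A *m B j *m C)).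
  by rewrite -row_mul !colE -!row_mul mulmxA.
apply/matrixP => a b; rewrite [RHS]mxE; transitivity (row i (col l (A *m B j *m C)) 0 0).
  by rewrite -E !ord1.
by rewrite !mxE.
Qed.

Lemma tt3_storage (r : nat) :
  tt_storage (fun _ : 'I_3 => m) (tt3_rank r) = (m * (r * r + 2 * r))%N.
Proof. by rewrite /tt_storage !big_ord_recl big_ord0 /=; lia. Qed.

End ThreeTensors.

(** * Reduction to a real system *)

Section RealSolution.
Local Open Scope complex_scope.
Context {R : realType}.

Lemma fd_matrixE n (i j : 'I_n.-1) : fd_matrix R n i j = (laplacian (R := R) n i j)%:C.
Proof.
rewrite /laplacian /fd_matrix !mxE rmorphM/=; congr (_ * _).
  rewrite rmorphM/= fmorphV rmorphXn/= !rmorph_nat.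
  by rewrite -exprVn invf_div expr_div_n -[2 ^+ 2]natrX.
by case: eqP => _; [rewrite rmorph_nat|case: ifP => _; rewrite ?rmorphN1 ?rmorph0].
Qed.

(** The matrix is real, so real and imaginary parts separate; the imaginary part solves the
    homogeneous system, whose eigenvalues are positive, and vanishes. *)
Lemma fd_poisson_solution_real n (X : tensor R (fun _ : 'I_3 => n.-1)) :
  (0 < n)%N -> fd_poisson_solution X ->
  exists2 x, kron_sum_eq (laplacian n) x 1 &
    forall i j l, X (index3 i j l) = (x i j l)%:C.
Proof.
move=> n0 XE.
have E i j l : \sum_t X (index3 t j l) * (laplacian n i t)%:C +
    \sum_t X (index3 i t l) * (laplacian n j t)%:C +
    \sum_t X (index3 i j t) * (laplacian n l t)%:C = 1.
  have := congr1 (fun Y : tensor R _ => Y (index3 i j l)) XE.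
  rewrite sum_ffunE !big_ord_recl big_ord0 addr0 [RHS]ffunE addrA => <-.
  have -> : lift ord0 ord0 = @Ordinal 3 1 isT :> 'I_3 by exact: val_inj.
  have -> : lift ord0 (lift ord0 ord0) = @Ordinal 3 2 isT :> 'I_3 by exact: val_inj.
  have -> : ord0 = @Ordinal 3 0 isT :> 'I_3 by exact: val_inj.
  rewrite !mode_prod_index3; congr (_ + _ + _); apply: eq_bigr => t _;
    by rewrite fd_matrixE.
pose x i j l := complex.Re (X (index3 i j l)).
pose y i j l := complex.Im (X (index3 i j l)).
have ReM (z : R[i]) (a : R) : complex.Re (z * a%:C) = a * complex.Re z.
  by case: z => u v /=; rewrite mulr0 subr0 mulrC.
have ImM (z : R[i]) (a : R) : complex.Im (z * a%:C) = a * complex.Im z.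
  by case: z => u v /=; rewrite mulr0 add0r mulrC.
have ReD : {morph @complex.Re R : u v / u + v} by move=> [? ?] [? ?].
have ImD : {morph @complex.Im R : u v / u + v} by move=> [? ?] [? ?].
have xE : kron_sum_eq (laplacian n) x 1.
  move=> i j l; have := congr1 (@complex.Re R) (E i j l).
  rewrite !ReD !(big_morph _ ReD (erefl _)) => H.
  apply: etrans H.
  by congr (_ + _ + _); apply: eq_bigr => t _; rewrite ReM.
have yE : kron_sum_eq (laplacian n) y 0.
  move=> i j l; have := congr1 (@complex.Im R) (E i j l).
  rewrite !ImD !(big_morph _ ImD (erefl _)) => H.
  apply: etrans H.
  by congr (_ + _ + _); apply: eq_bigr => t _; rewrite ImM.
exists x => // i j l.
have [U [UU UK]] := laplacian_eigenbasis (R := R) n.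
have lam0 a : 0 < laplacian_eigenvalue (R := R) n (a : 'I_n.-1).
  by have /andP[? _] := laplacian_eigenvalue_bounds (R := R) a; lra.
have := kron_sum_solution UU UK lam0 yE i j l.
rewrite (@bwd3_eq _ _ _ _ (fun _ _ _ => 0)); last by move=> *; rewrite !mul0r.
rewrite /bwd3 big1 => [|a _]; last first.
  by rewrite big1 ?mulr0// => b _; rewrite big1 ?mulr0// => c _; rewrite mulr0.
rewrite /y /x; case: (X _) => u v /= ->.
by [].
Qed.

Lemma frob_norm3 m (X : tensor R (fun _ : 'I_3 => m)) x :
  (forall i j l, X (index3 i j l) = (x i j l)%:C) ->
  frob_norm X = Num.sqrt (sum3 (fun i j l => x i j l ^+ 2)).
Proof.
move=> Xx; rewrite /frob_norm sum_mindex3; congr Num.sqrt.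
apply: eq_bigr => i _; apply: eq_bigr => j _; apply: eq_bigr => l _.
by rewrite Xx /= expr0n addr0 sqrtr_sqr real_normK// num_real.
Qed.

End RealSolution.

(** * The storage bound and its asymptotics *)

Section PoissonCompression.
Context {R : realType}.

Definition poisson_tt_rank (n : nat) (e : R) : int :=
  Num.ceil (1 / pi ^+ 2
    * ln (16 * (n%:R ^+ 2 + 2) * (2 * n%:R ^+ 2 + 1) / (9 * n%:R ^+ 2))
    * ln (4 * Num.sqrt 3 / e)).

Let nsqr_gt1 n : (2 <= n)%N -> 1 < n%:R ^+ 2 :> R.
Proof. by move=> n2; rewrite exprn_egt1// ltr1n. Qed.

Let cross_ratio_gt0 n : (2 <= n)%N ->
  0 < ln (16 * (n%:R ^+ 2 + 2) * (2 * n%:R ^+ 2 + 1) / (9 * n%:R ^+ 2)) :> R.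
Proof.
move=> /nsqr_gt1; move: (n%:R ^+ 2) => b b1; rewrite ln_gt0//.
by rewrite ltr_pdivlMr ?mulr_gt0//; nra.
Qed.

Let sqrt3_bounds : 1 < Num.sqrt 3 :> R /\ 4 * Num.sqrt 3 < 7 :> R.
Proof.
have s0 : 0 <= Num.sqrt 3 :> R by exact: sqrtr_ge0.
have s3 : Num.sqrt 3 ^+ 2 = 3 :> R by rewrite sqr_sqrtr.
by split; nra.
Qed.

Let ln_accuracy_gt0 (e : R) : 0 < e < 1 -> 0 < ln (4 * Num.sqrt 3 / e).
Proof.
move=> /andP[e0 e1]; have [s1 _] := sqrt3_bounds.
by rewrite ln_gt0// ltr_pdivlMr// mul1r; lra.
Qed.

Let poisson_tt_rank_gt0 n e : (2 <= n)%N -> 0 < e < 1 -> 0 < poisson_tt_rank n e.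
Proof.
move=> n2 e01; rewrite /poisson_tt_rank -(ltr_int R) (lt_le_trans _ (ceil_ge _))//.
rewrite !mulr_gt0 ?invr_gt0 ?exprn_gt0 ?pi_gt0//.
  exact: cross_ratio_gt0.
exact: ln_accuracy_gt0.
Qed.

Lemma poisson_pTT_le n (X : tensor R (fun _ : 'I_3 => n.-1)) (e : R) :
  (2 <= n)%N -> fd_poisson_solution X -> 0 < e < 1 ->
  (pTT e X)%:Z <= n%:Z * (poisson_tt_rank n e ^+ 2 + 2 * poisson_tt_rank n e).
Proof.
move=> n2 XE e01; have /andP[e0 e1] := e01.
have n0 : (0 < n)%N by exact: ltnW.
have [x xK Xx] := fd_poisson_solution_real n0 XE.
have [U [UU UK]] := laplacian_eigenbasis (R := R) n.
have s_gt0 := poisson_tt_rank_gt0 n2 e01.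
set k := absz (poisson_tt_rank n e).
have kE : poisson_tt_rank n e = k%:Z by rewrite /k gtz0_abs.
have k0 : (0 < k)%N by rewrite -ltz_nat -kE.
have [r [A [B [rk]]]] := kron_sum_tt_approx UU UK
  (@laplacian_eigenvalue_bounds R n) xK (nsqr_gt1 n2) k0.
set L := ln _; set Z := 4 * expR _ => err.
have L0 : 0 < L by exact: cross_ratio_gt0.
(* The ceiling guarantees Z <= e / sqrt 3, which leaves a margin: 2 Z^2 <= 2 e^2 / 3. *)
have ZE : 2 * Z ^+ 2 <= e ^+ 2.
  have [s1 _] := sqrt3_bounds.
  have s3 : Num.sqrt 3 ^+ 2 = 3 :> R by rewrite sqr_sqrtr.
  have Ze : Z <= e / Num.sqrt 3.
    rewrite (_ : e / Num.sqrt 3 = 4 * expR (- ln (4 * Num.sqrt 3 / e))); last first.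
      have s0 : 0 < Num.sqrt 3 :> R by lra.
      rewrite expRN lnK ?posrE; last by rewrite divr_gt0 ?mulr_gt0.
      by field; rewrite (gt_eqF s0) (gt_eqF e0).
    rewrite ler_pM2l// ler_expR lerN2 ler_pdivlMr//.
    have : 1 / pi ^+ 2 * L * ln (4 * Num.sqrt 3 / e) <= k%:R :> R.
      by have := ceil_ge (1 / pi ^+ 2 * L * ln (4 * Num.sqrt 3 / e)); rewrite -/(poisson_tt_rank n e) kE.
    have p0 : 0 < pi ^+ 2 :> R by rewrite exprn_gt0// pi_gt0.
    move=> H; rewrite -(ler_pM2l p0) in H.
    apply: le_trans H; rewrite le_eqVlt; apply/orP; left; apply/eqP.
    by move: (pi ^+ 2) p0 => p p0; field; rewrite gt_eqF.
  have Z0 : 0 <= Z by rewrite mulr_ge0// expR_ge0.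
  have : Z ^+ 2 <= (e / Num.sqrt 3) ^+ 2.
    by rewrite ler_pXn2r// nnegrE divr_ge0//; lra.
  by rewrite expr_div_n s3; have := sqr_ge0 e; lra.
pose cplx (p q : nat) (M : 'M[R]_(p, q)) := map_mx (real_complex R) M.
pose Y : tensor R (fun _ : 'I_3 => n.-1) := [ffun I : mindex (fun _ : 'I_3 => n.-1) =>
  ((A *m B (I (@Ordinal 3 1 isT)) *m A^T) (I (@Ordinal 3 0 isT)) (I (@Ordinal 3 2 isT)))%:C%C].
have YE i j l : Y (index3 i j l) = ((A *m B j *m A^T) i l)%:C%C.
  by rewrite ffunE !index3E.
have Yrank : tt_rank_le (tt3_rank r) Y.
  apply: (@tt3_rank_le _ _ _ (cplx _ _ A) (fun j => cplx _ _ (B j)) (cplx _ _ A^T)).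
  move=> i j l; rewrite YE /cplx.
  by rewrite -!map_mxM [RHS]mxE.
have H : (pTT e X <= n.-1 * (r * r + 2 * r))%N.
  apply: (pTTP (isT : (0 < 3)%N) X (ltW e0)).2.
  exists (tt3_rank r), Y; split => //; first exact: tt3_storage.
  rewrite (frob_norm3 Xx).
  rewrite (@frob_norm3 _ _ _ (fun i j l => x i j l - (A *m B j *m A^T) i l)); last first.
    move=> i j l; have -> : (X - Y) (index3 i j l) = X (index3 i j l) - Y (index3 i j l).
      by rewrite !ffunE.
    by rewrite Xx YE rmorphB.
  rewrite -[e]ger0_norm ?(ltW e0)// -sqrtr_sqr -sqrtrM ?sqr_ge0//.
  rewrite ler_wsqrtr//; apply: (le_trans err); rewrite ler_wpM2r//.
  by do 3! [apply: sumr_ge0 => ? _]; rewrite sqr_ge0.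
rewrite kE.
have : (pTT e X <= n * (k ^ 2 + 2 * k))%N.
  apply: (leq_trans H); apply: leq_mul; first exact: leq_pred.
  by rewrite mulnn leq_add ?leq_sqr ?leq_mul2l ?rk ?orbT.
by rewrite -lez_nat PoszM PoszD PoszM.
Qed.

Let ln_ge_half (x : R) : 2 <= x -> 1 / 2 <= ln x.
Proof.
move=> x2; have x0 : 0 < x by lra.
rewrite -[leLHS]expRK ler_ln ?posrE ?expR_gt0//; apply: le_trans x2.
have := expR_ge1Dx (- (1 / 2) : R).
rewrite expRN => H; have e0 := expR_gt0 (1 / 2 : R).
have : (1 - 1 / 2) * expR (1 / 2) <= 1 :> R by rewrite -ler_pdivlMr// [leRHS]div1r.
by lra.
Qed.

(** The argument of the first logarithm is at most n^5, and that of the second at most 1 / e^2, as 4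
    sqrt 3 < 7. With pi >= 2 the product is at most (5 / 2) u for u = ln n * ln (1 / e); since u >=
    1 / 4, the 1 lost to the ceiling costs at most 4 u, and 5 / 2 + 4 <= 7. *)
Lemma poisson_tt_rank_asymptotic n e : (2 <= n)%N -> 0 < e < 1 / 7 ->
  (poisson_tt_rank n e)%:~R <= 7 * (ln n%:R * ln (1 / e)) :> R.
Proof.
move=> n2 /andP[e0 e7].
have n2R : 2 <= n%:R :> R by rewrite ler_nat.
have nR : 0 < n%:R :> R by lra.
have lnn := ln_ge_half n2R.
have e1 : 2 <= 1 / e by rewrite ler_pdivlMr//; lra.
have lne := ln_ge_half e1.
rewrite /poisson_tt_rank; set c := _ * ln _ * ln _.
have c1 : (Num.ceil c)%:~R <= c + 1.
  by have /andP[] := ceil_itv c; rewrite intrB; lra.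
have L5 : ln (16 * (n%:R ^+ 2 + 2) * (2 * n%:R ^+ 2 + 1) / (9 * n%:R ^+ 2)) <=
    5 * ln n%:R :> R.
  rewrite (_ : 5 * _ = ln (n%:R ^+ 5)); last by rewrite lnXn// mulr_natl.
  rewrite ler_ln ?posrE ?exprn_gt0//; last first.
    by rewrite divr_gt0 ?mulr_gt0 ?addr_gt0 ?mulr_gt0 ?exprn_gt0.
  rewrite ler_pdivrMr ?mulr_gt0 ?exprn_gt0//.
  have := nsqr_gt1 n2; have : 4 <= n%:R ^+ 2 :> R by nra.
  rewrite (_ : n%:R ^+ 5 * (9 * n%:R ^+ 2) = 9 * n%:R * (n%:R ^+ 2) ^+ 3); last by ring.
  move: (n%:R ^+ 2) => b b4 b1.
  apply: (@le_trans _ _ (18 * b ^+ 3)); last by rewrite ler_wpM2r ?exprn_ge0; lra.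
  have : 0 <= (b - 4) * b * b by rewrite !mulr_ge0; lra.
  by nra.
have L2 : ln (4 * Num.sqrt 3 / e) <= 2 * ln (1 / e).
  have [s1 s7] := sqrt3_bounds.
  rewrite (_ : 2 * _ = ln ((1 / e) ^+ 2)); last by rewrite lnXn ?divr_gt0// mulr_natl.
  have a1 : 0 < 4 * Num.sqrt 3 / e by rewrite divr_gt0//; lra.
  have a2 : 0 < (1 / e) ^+ 2 by rewrite exprn_gt0 ?divr_gt0.
  rewrite ler_ln ?posrE//.
  rewrite expr2 mulrA ler_pM2r ?invr_gt0// mulr1 ler_pdivlMr//.
  by move: (Num.sqrt 3) s1 s7 => s *; nra.
have p4 : 1 / pi ^+ 2 <= 1 / 4 :> R.
  rewrite !div1r lef_pV2 ?posrE ?exprn_gt0 ?pi_gt0//.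
  by have := @pi_ge2 R; nra.
have c0 : 0 <= 1 / pi ^+ 2 :> R by rewrite divr_ge0 ?sqr_ge0.
have la0 : 0 < ln (4 * Num.sqrt 3 / e) by apply: ln_accuracy_gt0; rewrite e0; lra.
have lc0 := cross_ratio_gt0 n2.
have cle : c <= 1 / 4 * (5 * ln n%:R) * (2 * ln (1 / e)).
  have la0' := ltW la0; have lc0' := ltW lc0.
  by rewrite /c; do 2! [apply: ler_pM => //; try exact: mulr_ge0].
have : 1 / 2 * (1 / 2) <= ln n%:R * ln (1 / e) :> R.
  by apply: ler_pM => //; lra.
move: cle c1; rewrite (_ : 1 / 4 * _ * _ = 5 / 2 * (ln n%:R * ln (1 / e))); last by field.
move: (ln n%:R * ln (1 / e)) (Num.ceil c)%:~R => u v; lra.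
Qed.

(** 147 = 3 * 7^2, as s^2 + 2 s <= 3 s^2 for s >= 1. *)
Lemma poisson_pTT_asymptotic n (X : tensor R (fun _ : 'I_3 => n.-1)) (e : R) :
  (2 <= n)%N -> fd_poisson_solution X -> 0 < e < 1 / 7 ->
  (pTT e X)%:R <= 147 * (n%:R * ln n%:R ^+ 2 * ln (1 / e) ^+ 2) :> R.
Proof.
move=> n2 XE e7; have e01 : 0 < e < 1 by case/andP: e7 => ? ?; apply/andP; split; lra.
have := poisson_pTT_le n2 XE e01.
have := poisson_tt_rank_asymptotic n2 e7; have := poisson_tt_rank_gt0 n2 e01.
move: (poisson_tt_rank n e) => s s0 sle H.
have s1 : 1 <= s%:~R :> R by rewrite ler1z.
have : (pTT e X)%:R <= n%:R * (s%:~R ^+ 2 + 2 * s%:~R) :> R.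
  by move: H; rewrite -(ler_int R) !intrM intrD intrM rmorphXn -!pmulrn.
move=> {}H; apply: (le_trans H).
rewrite (_ : 147 * _ = n%:R * (3 * (7 * (ln n%:R * ln (1 / e))) ^+ 2)); last by ring.
rewrite ler_wpM2l//.
move: sle s1; move: (7 * _) (s%:~R) => u v vu v1.
have : v ^+ 2 <= u ^+ 2 by rewrite ler_pXn2r// nnegrE; lra.
by nra.
Qed.

End PoissonCompression.

Theorem mainTheorem3 (R : realType) :
  (forall (n : nat) (X : tensor R (fun _ : 'I_3 => n.-1)) (e : R),
     (2 <= n)%N -> fd_poisson_solution X -> 0 < e < 1 ->
     let s1 : int := Num.ceil
       (1 / pi ^+ 2
        * ln (16 * (n%:R ^+ 2 + 2) * (2 * n%:R ^+ 2 + 1) / (9 * n%:R ^+ 2))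
        * ln (4 * Num.sqrt 3 / e)) in
     (pTT e X)%:Z <= n%:Z * (s1 ^+ 2 + 2 * s1))
  /\
  (forall X : forall n : nat, tensor R (fun _ : 'I_3 => n.-1),
     (forall n : nat, (2 <= n)%N -> fd_poisson_solution (X n)) ->
     (fun ne : nat * R => (pTT ne.2 (X ne.1))%:R : R)
       =O_ (filter_prod \oo (0 : R)^'+)
     (fun ne : nat * R =>
        ne.1%:R * ln ne.1%:R ^+ 2 * ln (1 / ne.2) ^+ 2 : R)).
Proof.
split=> [n X e n2 XE e01 /=|X XE]; first exact: poisson_pTT_le.
apply/eqO_exP; exists 147 => //.
(* The bound is uniform on this product neighbourhood, so n and e approach their limits
   independently. *)
exists ([set n | (2 <= n)%N], [set e : R | 0 < e < 1 / 7]) => /=.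
  split; first by exists 2%N.
  near=> e; apply/andP; split; first by near: e; exact: nbhs_right_gt.
  by near: e; apply: nbhs_right_lt.
move=> [n e] /= [n2 e7]; rewrite ger0_norm//.
apply: (le_trans (poisson_pTT_asymptotic n2 (XE n n2) e7)).
by rewrite ler_pM2l// ler_norm.
Unshelve. all: by end_near. Qed.
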